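(* Let $p$ be a prime and let $G$ be a $p$-group of maximal class of order $p^n$ with $n\ge 4$. Then the Bogomolov multiplier $\mathrm{B}_0(G)$ is trivial if and only if $[P_1,P_1]=[P_1,P_{n-2}]$.
   Context: A $p$-group of maximal class is a group of order $p^n$ and nilpotency class $n-1$. For such $G$ with $n\ge 4$, set $P_i=\gamma_i(G)$ (the $i$-th term of the lower central series) for $i\ge 2$, and $P_1=C_G(P_2/P_4)$; also $P_i=1$ for $i\ge n$. Commutators are $[x,y]=x^{-1}y^{-1}xy$ and $x^y=y^{-1}xy$. The curly exterior square $G\curlywedge G$ is the group generated by symbols $x\curlywedge y$ ($x,y\in G$) subject to the relations $xy\curlywedge z=(x^y\curlywedge z^y)(y\curlywedge z)$, $x\curlywedge yz=(x\curlywedge z)(x^z\curlywedge y^z)$ for all $x,y,z\in G$, and $a\curlywedge b=1$ whenever $[a,b]=1$. There is a canonical epimorphism $G\curlywedge G\to[G,G]$, $x\curlywedge y\mapsto [x,y]$; the Bogomolov multiplier $\mathrm{B}_0(G)$ is (isomorphic to) its kernel. *)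

(* Defs.v *)
From HB Require Import structures.
From mathcomp Require Import all_boot all_order all_fingroup all_solvable.
Set Implicit Arguments. Unset Strict Implicit. Unset Printing Implicit Defensive.
Local Open Scope group_scope.

(* Letters of the free group on the symbols x ⋏ y (x, y in the whole group gT):
   (x, y, false) stands for x ⋏ y and (x, y, true) for (x ⋏ y)^-1.
   Words are sequences of letters. *)
Definition letter (gT : finGroupType) := (gT * gT * bool)%type.

(* The congruence on words generated by free cancellation and by the defining
   relations of the curly exterior square; words modulo [curly_rel] are exactly
   the elements of G ⋏ G. *)
Inductive curly_rel (gT : finGroupType) : seq (letter gT) -> seq (letter gT) -> Prop :=
| cr_refl w : curly_rel w w
| cr_sym u v : curly_rel u v -> curly_rel v u
| cr_trans u v w : curly_rel u v -> curly_rel v w -> curly_rel u w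
| cr_ctx a b u v : curly_rel u v -> curly_rel (a ++ u ++ b) (a ++ v ++ b)
| cr_free (x y : gT) (e : bool) : curly_rel [:: (x, y, e); (x, y, ~~ e)] [::]
| cr_left (x y z : gT) :
    curly_rel [:: (x * y, z, false)] [:: (x ^ y, z ^ y, false); (y, z, false)]
| cr_right (x y z : gT) :
    curly_rel [:: (x, y * z, false)] [:: (x, z, false); (x ^ z, y ^ z, false)]
| cr_comm (a b : gT) : commute a b -> curly_rel [:: (a, b, false)] [::].

Definition curly_eval (gT : finGroupType) (w : seq (letter gT)) : gT :=
  foldr (fun l acc =>
           (if l.2 then [~ l.1.1, l.1.2]^-1 else [~ l.1.1, l.1.2]) * acc) 1 w.

(* B_0(G) (the kernel of G ⋏ G -> [G,G]) is trivial, for G = [set: gT]. *)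
Definition B0_trivial (gT : finGroupType) : Prop :=
  forall w : seq (letter gT), curly_eval w = 1 -> curly_rel w [::].

Definition P1 (gT : finGroupType) (G : {set gT}) : {set gT} :=
  G :&: coset 'L_4(G) @*^-1 'C('L_2(G) / 'L_4(G)).

(* Main.v *)
(* Write [H] for [P_1] and let [H' = [H, H] = P_m].

   If [H'] is trivial, or of prime order and equal to [[P_1, P_(n-2)]], choose
   [s] outside [H] that centralizes [P_(n-2)] in the second case.  Every element
   of the curly square is [(a ⋏ s) c] with [a] in [H] and [c] in the central
   subgroup generated by the [h ⋏ h'], [h, h'] in [H].  On that subgroup the
   commutator map is injective: [h ⋏ h'] depends only on [[h, h']], because
   non-commuting elements of [H] are linked through common non-commuting ones.
   Moreover [[a, s]] in [H'] forces [[a, s] = 1], hence [a ⋏ s = 1].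

   Conversely, suppose [H' <> [P_1, P_(n-2)]].  Then an element of [H] commuting
   with some [x] outside [H] lies in [H'].  So on the [<s>]-module [H / H'] the
   norm vanishes and the commutator map can be divided by [s - 1]; this gives a
   homomorphism from the curly square to [H / H'] that kills [H ⋏ H] and sends
   [a ⋏ s] to [a].  For [a] in [P_(m-1)] outside [P_m], the element [[a, s]] is a
   product of commutators of [H], which gives a non-trivial element of the
   Bogomolov multiplier.

   The statement on centralizers could only fail at level [k = m - 1] with
   [m <= n - 2].  There [H' / P_(m+1)] is the centre of the extraspecial group
   [H / P_(m+1)], of order [p^(k+1)] with [k] even, and comparing commutators of
   weights [k + 1] and [k + 2] gives [p | k / 2], whereas [k <= p]. *)
From HB Require Import structures.
From mathcomp Require Import all_boot all_order all_fingroup all_solvable.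
From mathcomp Require Import generic_quotient boolp zify.
Require Import Defs.
Set Implicit Arguments. Unset Strict Implicit. Unset Printing Implicit Defensive.
Local Open Scope group_scope.

(** * Pairings on the curly exterior square *)

Section CurlyPairing.
Variables (gT : finGroupType) (K : groupType) (t : gT -> gT -> K).

Definition curly_pairing :=
  [/\ forall x y z, t (x * y) z = t (x ^ y) (z ^ y) * t y z,
      forall x y z, t x (y * z) = t x z * t (x ^ z) (y ^ z) &
      forall a b, commute a b -> t a b = 1].

Definition pairing_eval (w : seq (letter gT)) : K :=
  foldr (fun l acc =>
    (if l.2 then (t l.1.1 l.1.2)^-1 else t l.1.1 l.1.2) * acc) 1 w.

Lemma pairing_eval_cat u v : pairing_eval (u ++ v) = pairing_eval u * pairing_eval v.
Proof. by elim: u => [|l u IHu] /=; rewrite ?mul1g // IHu mulgA. Qed.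

Hypothesis t_pairing : curly_pairing.
Let tMl := let: And3 h _ _ := t_pairing in h.
Let tMr := let: And3 _ h _ := t_pairing in h.
Let t_comm := let: And3 _ _ h := t_pairing in h.

Lemma pairing_eval_curly_rel u v : curly_rel u v -> pairing_eval u = pairing_eval v.
Proof.
elim=> {u v} //= [u v w _ -> _ -> // | a b u v _ IH | x y [] | x y z | x y z | a b cab].
- by rewrite !pairing_eval_cat IH.
- by rewrite mulg1 mulVg.
- by rewrite mulg1 mulgV.
- by rewrite !mulg1 tMl.
- by rewrite !mulg1 tMr.
- by rewrite t_comm ?mul1g.
Qed.

(** Expand [t (u * y) (u * y) = 1] in both arguments; writing [x] as [u ^ y] makes the conjugations
    cancel. *)
Lemma pairing_antisym x y : t x y * t y x = 1.
Proof.
have tt z : t z z = 1 by apply: t_comm.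
pose u := x ^ y^-1; have -> : x = u ^ y by rewrite /u -conjgM mulVg conjg1.
have yy : y ^ y = y by rewrite conjgE mulKg.
have := tt (u * y); rewrite (tMl u y) (conjMg u y y) yy (tMr (u ^ y)) (tMr y u) !tt.
by rewrite yy mulg1 mul1g.
Qed.

(** Both sides arise from [t (a * y) (b * w)], expanded first on the left or first on the right.
    Thus conjugation by the value [t y w] acts on the arguments as conjugation by [[~ y, w]]. *)
Lemma pairing_conj x z y w :
  t x z * t y w = t y w * t (x ^ [~ y, w]) (z ^ [~ y, w]).
Proof.
pose a := x ^ (w * y)^-1; pose b := z ^ (w * y)^-1.
have -> : x = a ^ (w * y) by rewrite /a -conjgM mulVg conjg1.
have -> : z = b ^ (w * y) by rewrite /b -conjgM mulVg conjg1.
have e : w * y * [~ y, w] = y * w by rewrite -commgC.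
rewrite -![(_ ^ _) ^ _]conjgM e.
have eqw : w * y = y * w ^ y by rewrite conjgC.
have eqy : y * w = w * y ^ w by rewrite conjgC.
have := tMr (a * y) b w; rewrite (tMl a y (b * w)) (conjMg b w y).
rewrite (tMr (a ^ y) (b ^ y)) (tMr y b) (tMl a y w) (conjMg a y w) (tMl (a ^ w) (y ^ w)).
rewrite -![(_ ^ _) ^ _]conjgM -eqw -eqy -!mulgA => /mulgI.
by rewrite !mulgA => /mulIg.
Qed.

End CurlyPairing.

(** * Normal forms when the commutators of a normal subgroup are central *)

Section NormalForm.
Variables (gT : finGroupType) (K : groupType) (t : gT -> gT -> K).
Variables (H : {group gT}) (s : gT).
Hypothesis t_pairing : curly_pairing t.
Hypothesis nHG : forall h g, h \in H -> h ^ g \in H.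
Hypothesis genG : forall g, exists2 h, h \in H & exists j, g = h * s ^+ j.
Hypothesis cHH : forall h k g, h \in H -> k \in H -> commute [~ h, k] g.
Let tMl := let: And3 h _ _ := t_pairing in h.
Let tMr := let: And3 _ h _ := t_pairing in h.
Let t_comm := let: And3 _ _ h := t_pairing in h.

Definition word_in (A : {set gT}) (w : seq (letter gT)) :=
  all (fun l => (l.1.1 \in A) && (l.1.2 \in A)) w.

Lemma pairing_central h k x y : h \in H -> k \in H -> commute (t h k) (t x y).
Proof.
move=> Hh Hk; apply: commute_sym; rewrite /commute pairing_conj //.
by congr (_ * t _ _); rewrite conjgE -(cHH _ Hh Hk) mulKg.
Qed.

Lemma pairing_eval_central v x y : word_in H v -> commute (pairing_eval t v) (t x y).
Proof.
elim: v => [|[[h k] e] v IHv] /=; first by move=> _; exact/commute_sym/commute1.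
case/andP=> /andP[Hh Hk] /IHv cv; apply: commute_sym; apply: commuteM; last exact: commute_sym.
have ct : commute (t x y) (t h k) by apply/commute_sym/pairing_central.
by case: e => //=; apply: commuteV.
Qed.

(** Conjugation inside [H] only multiplies by central elements, on which [t] is trivial, so the
    twisted product rule loses its twist. *)
Lemma pairing_class2_Ml a b k : a \in H -> b \in H -> k \in H ->
  t (a * b) k = t a k * t b k.
Proof.
move=> Ha Hb Hk; rewrite tMl; congr (_ * _).
have fixz (z u : gT) : (forall g, commute z g) -> u ^ z = u.
  by move=> cz; rewrite conjgE -cz mulKg.
have fixb (u : gT) : u \in H -> exists2 z, u ^ b = u * z & forall g, commute z g.
  by move=> Hu; exists [~ u, b]; [rewrite mulKVg | move=> g; apply: cHH].
have [z -> cz] := fixb a Ha; have [z' -> cz'] := fixb k Hk.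
rewrite tMl !fixz // (t_comm (cz _)) mulg1 tMr !fixz // t_comm ?mul1g //.
exact/commute_sym.
Qed.

Lemma pairing_class2_Mr a b k : a \in H -> b \in H -> k \in H ->
  t k (a * b) = t k a * t k b.
Proof.
move=> Ha Hb Hk; apply: (mulIg (t (a * b) k)).
rewrite pairing_antisym // pairing_class2_Ml // (pairing_central b k Ha Hk).
by rewrite !mulgA -[_ * t k b * _]mulgA pairing_antisym // mulg1 pairing_antisym.
Qed.

Definition in_form (u : K) :=
  exists2 a, a \in H & exists2 v, word_in H v & u = t a s * pairing_eval t v.

Lemma word_in1 h k : h \in H -> k \in H -> word_in H [:: (h, k, false)].
Proof. by move=> Hh Hk; rewrite /word_in /= Hh Hk. Qed.

Lemma in_formC v : word_in H v -> in_form (pairing_eval t v).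
Proof.
by exists 1 => //; exists v; rewrite // t_comm ?mul1g //; exact/commute_sym/commute1.
Qed.

(** The conjugate [s ^ b] is an element of [H] times [s]; the right product rule splits this element
    off as the central correction [t c d]. *)
Lemma pairing_form_Ml a b : a \in H -> b \in H ->
  exists2 c, c \in H & exists2 d, d \in H & t (a * b) s = t a s * t b s * t c d.
Proof.
move=> Ha Hb.
have Hsb1 : [~ s, b] \in H by rewrite commgEr groupM // nHG // groupV.
exists (a ^ s); first exact: nHG.
exists (([~ s, b] ^ s^-1) ^ s); first by rewrite !nHG.
have Hsb : s ^ b = [~ s, b] ^ s^-1 * s by rewrite -conjgCV mulKVg.
have fixz (z u : gT) : (forall g, commute z g) -> u ^ z = u.
  by move=> cz; rewrite conjgE -cz mulKg.
have -> : t (a * b) s = t a (s ^ b) * t b s.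
  rewrite tMl; congr (_ * _).
  have -> : a ^ b = a * [~ a, b] by rewrite mulKVg.
  have cz g := cHH g Ha Hb.
  by rewrite tMl !(fixz _ _ cz) (t_comm (cz _)) mulg1.
rewrite Hsb tMr -!mulgA; congr (_ * _).
by apply: pairing_central; rewrite !nHG.
Qed.

Lemma in_formM u v : in_form u -> in_form v -> in_form (u * v).
Proof.
case=> a Ha [c Hc ->] [b Hb [d Hd ->]].
have [e He [f Hf Eab]] := pairing_form_Ml Ha Hb.
exists (a * b); first exact: groupM.
(* By antisymmetry the swapped letter [(f, e, false)] cancels the correction [t e f]. *)
exists ((f, e, false) :: c ++ d).
  by rewrite /word_in /= He Hf all_cat /=; apply/andP.
rewrite /= Eab pairing_eval_cat -!mulgA; congr (_ * _).
rewrite [in LHS]mulgA (pairing_eval_central b s Hc) -!mulgA; congr (_ * _).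
by rewrite [t e f * _]mulgA pairing_antisym // mul1g.
Qed.

Lemma word_in_invE v : word_in H v ->
  exists2 v', word_in H v' & pairing_eval t v' = (pairing_eval t v)^-1.
Proof.
elim: v => [|[[h k] e] v IHv]; first by exists [::]; rewrite //= invg1.
case/andP=> /= /andP[Hh Hk] Hv; have [v' Hv' Ev'] := IHv Hv.
exists (v' ++ [:: (h, k, ~~ e)]);
  first 
  by move: Hv'; rewrite /word_in all_cat => -> /=; rewrite Hh Hk.
by rewrite pairing_eval_cat Ev' invgM /= mulg1; case: e; rewrite ?invgK.
Qed.

Lemma in_formV u : in_form u -> in_form u^-1.
Proof.
case=> a Ha [c Hc ->]; have [c' Hc' Ec'] := word_in_invE Hc.
have Hav : a^-1 \in H by rewrite groupV.
have [e He [f Hf Eaa]] := pairing_form_Ml Hav Ha.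
exists a^-1 => //; exists (c' ++ [:: (e, f, false)]).
  by move: Hc'; rewrite /word_in all_cat => -> /=; rewrite He Hf.
rewrite invgM -Ec' pairing_eval_cat /= mulg1 mulgA -(pairing_eval_central _ _ Hc').
rewrite -mulgA; congr (_ * _); apply: (mulIg (t a s)); rewrite mulVg.
move: Eaa; rewrite mulVg t_comm; last exact/commute_sym/commute1.
by rewrite -mulgA -(pairing_central a s He Hf) mulgA => <-.
Qed.

Lemma in_form_l x y : x \in H -> in_form (t x y).
Proof.
move=> Hx; have [b Hb [j ->]] := genG y.
elim: j x b Hx Hb => [|j IHj] x b Hx Hb.
  rewrite mulg1; have := in_formC (word_in1 Hx Hb); by rewrite /= mulg1.
rewrite expgSr mulgA tMr conjMg conjXg [s ^ s]conjgE mulKg.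
apply: in_formM; last by apply: IHj; apply: nHG.
by exists x => //; exists [::]; rewrite //= mulg1.
Qed.

Lemma in_form_pairing x y : in_form (t x y).
Proof.
have in_form_s z : in_form (t s z).
  have [b Hb [j ->]] := genG z.
  elim: j b Hb => [|j IHj] b Hb.
    rewrite mulg1; have := in_formV (in_form_l s Hb).
    by congr in_form; apply: (mulIg (t b s)); rewrite mulVg pairing_antisym.
  rewrite expgSr mulgA tMr t_comm // mul1g conjMg conjXg [s ^ s]conjgE mulKg.
  by apply: IHj; apply: nHG.
have [a Ha [j ->]] := genG x.
elim: j a y Ha => [|j IHj] a y Ha; first by rewrite mulg1; apply: in_form_l.
rewrite expgSr mulgA tMl conjMg conjXg [s ^ s]conjgE mulKg.
by apply: in_formM => //; apply: IHj; apply: nHG.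
Qed.

Lemma in_form_eval w : in_form (pairing_eval t w).
Proof.
elim: w => [|[[x y] e] w IHw] /=; first exact: (@in_formC [::]).
by apply: in_formM => //; case: e; [apply: in_formV|]; apply: in_form_pairing.
Qed.
End NormalForm.

(** * Pairings on a subgroup with central derived subgroup of prime order *)

Section PrimeCommutator.
Variables (gT : finGroupType) (K : groupType) (t : gT -> gT -> K).
Variables (H : {group gT}) (p : nat).
Hypothesis t_pairing : curly_pairing t.
Hypothesis cHH : forall h k g, h \in H -> k \in H -> commute [~ h, k] g.
Hypothesis p_pr : prime p.
Hypothesis oH' : #|[~: H, H]| = p.
Let t_comm := let: And3 _ _ h := t_pairing in h.

Let tXl a b i : a \in H -> b \in H -> t (a ^+ i) b = t a b ^+ i.
Proof.
move=> Ha Hb; elim: i => [|i IHi]; first by apply/t_comm/commute_sym/commute1.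
by rewrite !expgS (pairing_class2_Ml t_pairing cHH) ?groupX // IHi.
Qed.

Let tXr a b i : a \in H -> b \in H -> t b (a ^+ i) = t b a ^+ i.
Proof.
move=> Ha Hb; elim: i => [|i IHi]; first exact/t_comm/commute1.
by rewrite !expgS (pairing_class2_Mr t_pairing cHH) ?groupX // IHi.
Qed.

Let powc a b u : a \in H -> b \in H -> [~ a, b] != 1 -> u \in [~: H, H] ->
  exists r, u = [~ a, b] ^+ r.
Proof.
move=> Ha Hb nt Hu; apply/cycleP; suff <- : [~: H, H] = <[[~ a, b]]> by [].
apply/esym/eqP; rewrite eqEcard cycle_subG mem_commg //= oH' dvdn_leq //.
have := order_dvdG (mem_commg Ha Hb); rewrite oH' -orderE => /(primeP p_pr).2.
by rewrite order_eq1 (negPf nt) => /eqP->.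
Qed.

(** Passing from one pair to another, commutator and pairing value are raised to the same power.
    Linking all pairs in this way makes the pairing value a function of the commutator. *)
Let pow_rel (ab ab' : gT * gT) := exists r,
  [~ ab'.1, ab'.2] = [~ ab.1, ab.2] ^+ r /\ t ab'.1 ab'.2 = t ab.1 ab.2 ^+ r.

Let pow_rel_trans u v w : pow_rel u v -> pow_rel v w -> pow_rel u w.
Proof. by case=> r [e1 e2] [q [e3 e4]]; exists (r * q)%N; rewrite !expgnA -e1 -e2. Qed.

Let pow_relr a b b' : a \in H -> b \in H -> b' \in H -> [~ a, b] != 1 ->
  pow_rel (a, b) (a, b').
Proof.
move=> Ha Hb Hb' nt; have [r Er] := powc Ha Hb nt (mem_commg Ha Hb').
(* The discrepancy [d] between [b'] and [b ^+ r] commutes with [a], so the pairing does not see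
   it. *)
exists r; split=> //=; set d := (b ^+ r)^-1 * b'.
have Hd : d \in H by rewrite groupM // groupV groupX.
have Er' : b' = b ^+ r * d by rewrite mulKVg.
have cad : commute a d.
  apply/commgP; move/eqP: Er; rewrite Er' commgMJ [_ ^ d]conjgE.
  rewrite (cHH d Ha) ?groupX // mulKg commgX; last exact/commute_sym/cHH.
  by rewrite -{2}[[~ a, b] ^+ r]mul1g (inj_eq (mulIg _)).
by rewrite Er' (pairing_class2_Mr t_pairing cHH) ?groupX // tXr // (t_comm cad) mulg1.
Qed.

Let pow_rell a a' b : a \in H -> a' \in H -> b \in H -> [~ a, b] != 1 ->
  pow_rel (a, b) (a', b).
Proof.
move=> Ha Ha' Hb nt; have [r Er] := powc Ha Hb nt (mem_commg Ha' Hb).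
exists r; split=> //=; set d := (a ^+ r)^-1 * a'.
have Hd : d \in H by rewrite groupM // groupV groupX.
have Er' : a' = a ^+ r * d by rewrite mulKVg.
have cad : commute d b.
  apply/commgP; move/eqP: Er; rewrite Er' commMgJ [_ ^ d]conjgE.
  rewrite (cHH d _ Hb) ?groupX // mulKg commXg; last exact/commute_sym/cHH.
  by rewrite -{2}[[~ a, b] ^+ r]mulg1 (inj_eq (mulgI _)).
by rewrite Er' (pairing_class2_Ml t_pairing cHH) ?groupX // tXl // (t_comm cad) mulg1.
Qed.

Lemma pairing_eval_prime v :
  word_in H v -> curly_eval v = 1 -> pairing_eval t v = 1.
Proof.
have /exists_inP[l Hl /exists_inP[l' Hl' ntl]] :
    [exists x in H, exists y in H, [~ x, y] != 1].
  apply: contraTT (prime_gt1 p_pr) => /exists_inPn noc.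
  rewrite -oH' -leqNgt -trivg_card_le1; apply/eqP/commG1P/centsP => a Ha b Hb.
  by apply/commgP; apply: contraNT (noc a Ha) => nt; apply/exists_inP; exists b.
have R h k : h \in H -> k \in H -> pow_rel (l, l') (h, k).
  move=> Hh Hk; have [c1 | nt] := eqVneq [~ h, k] 1.
    exists 0; split=> //=; rewrite t_comm //; exact/commgP/eqP.
  have Rm m : m \in H -> [~ l, m] != 1 -> [~ h, m] != 1 -> pow_rel (l, l') (h, k).
    move=> Hm lm hm; apply: pow_rel_trans (pow_relr Hl Hl' Hm ntl) _.
    exact: pow_rel_trans (pow_rell Hl Hh Hm lm) (pow_relr Hh Hm Hk hm).
  have [hl' | nt1] := eqVneq [~ h, l'] 1; last exact: Rm ntl nt1.
  have [lk | nt2] := eqVneq [~ l, k] 1; last exact: Rm nt2 nt.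
  (* Here [h] commutes with [l'] and [l] with [k], so the product [l' * k] commutes with neither [l]
     nor [h] and serves as the common link. *)
  apply: (Rm (l' * k)); rewrite ?groupM // commgMJ ?hl' ?lk ?conj1g ?mul1g ?mulg1 //.
  by rewrite conjg_eq1.
have oz : #[[~ l, l']] = p.
  have := order_dvdG (mem_commg Hl Hl'); rewrite oH' => /(primeP p_pr).2.
  by rewrite order_eq1 (negPf ntl) => /eqP.
have zp : [~ l, l'] ^+ p = 1 by rewrite -oz expg_order.
(* The pairing value has exponent [p] too, because [l ^+ p] commutes with [l']. *)
have cp : t l l' ^+ p = 1.
  rewrite -tXl // t_comm //; apply/commgP; rewrite commXg ?zp //.
  exact/commute_sym/cHH.
suff E : word_in H v -> exists r,
    curly_eval v = [~ l, l'] ^+ r /\ pairing_eval t v = t l l' ^+ r.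
  case/E=> r [-> ->] /eqP; rewrite -order_dvdn oz => /dvdnP[q ->].
  by rewrite mulnC expgnA cp expg1n.
elim: v => [|[[h k] e] v IHv]; first by exists 0.
case/andP=> /= /andP[Hh Hk] /IHv[r [-> ->]]; have [q /= [-> ->]] := R h k Hh Hk.
case: e; last by exists (q + r)%N; rewrite !expgnDr.
(* Exponents are natural numbers, so inversion is written as the power [p.-1]. *)
exists (q * p.-1 + r)%N; rewrite !expgnDr !expgnA.
suff inv (L : groupType) (u : L) : u ^+ p = 1 -> u^-1 = u ^+ p.-1.
  by rewrite !inv // -?expgnA mulnC expgnA ?zp ?cp expg1n.
by move=> up; apply: mulg1_eq; rewrite -expgS prednK ?prime_gt0.
Qed.

End PrimeCommutator.

(** * The curly exterior square as a quotient of words *)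

Section CurlySquare.
Local Open Scope quotient_scope.
Variable gT : finGroupType.
Implicit Types u v w : seq (letter gT).

(** The congruence is made boolean by classical reflection, as the quotient type requires. *)
Definition curly_eq (u v : seq (letter gT)) := `[< curly_rel u v >].

Lemma curly_eq_equiv : equiv_class_of curly_eq.
Proof.
split=> [u | u v | v u w].
- exact/asboolP/cr_refl.
- by apply/idP/idP => /asboolP h; apply/asboolP/cr_sym.
- by move=> /asboolP h1 /asboolP h2; apply/asboolP/(cr_trans h1).
Qed.

Canonical curly_equiv := EquivRelPack curly_eq_equiv.
Definition curly_square := {eq_quot curly_eq}.
HB.instance Definition _ := Choice.on curly_square.

Let pi (w : seq (letter gT)) : curly_square := \pi_{eq_quot curly_eq} w.

Lemma curly_piP u v : pi u = pi v <-> curly_rel u v.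
Proof. by split=> [/eqmodP/asboolP | h]; [|apply/eqmodP/asboolP]. Qed.

Let flip (w : seq (letter gT)) : seq (letter gT) := rev [seq (l.1, ~~ l.2) | l <- w].

Lemma curly_rel_cat u (u' : seq (letter gT)) v (v' : seq (letter gT)) :
  curly_rel u u' -> curly_rel v v' -> curly_rel (u ++ v) (u' ++ v').
Proof.
move=> hu hv; apply: cr_trans (cr_ctx [::] v hu) _.
by have := cr_ctx u' [::] hv; rewrite !cats0.
Qed.

Lemma curly_rel_flip w : curly_rel (flip w ++ w) [::].
Proof.
elim: w => [|[[x y] e] w IHw]; first exact: cr_refl.
rewrite /flip /= rev_cons -cats1 -catA /=; apply: cr_trans _ IHw.
have := cr_ctx (flip w) w (cr_free x y (~~ e)); by rewrite negbK.
Qed.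

Let cmul (a b : curly_square) := pi (repr a ++ repr b).
Let cinv (a : curly_square) := pi (flip (repr a)).

Lemma curly_repr w : curly_rel (repr (pi w)) w.
Proof. by apply/curly_piP; rewrite /pi reprK. Qed.

Lemma curly_mulA : associative cmul.
Proof.
move=> a b c; apply/curly_piP; apply: cr_trans (curly_rel_cat (cr_refl _) (curly_repr _)) _.
by rewrite catA; apply: curly_rel_cat (cr_refl _); apply/cr_sym/curly_repr.
Qed.

Lemma curly_mul1 : left_id (pi [::]) cmul.
Proof.
move=> a; rewrite -{2}[a]reprK; apply/curly_piP.
exact: curly_rel_cat (curly_repr [::]) (cr_refl _).
Qed.

Lemma curly_1mul : right_id (pi [::]) cmul.
Proof.
move=> a; rewrite -[RHS]reprK; apply/curly_piP.
by have := curly_rel_cat (cr_refl (repr a)) (curly_repr [::]); rewrite cats0.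
Qed.

Lemma curly_Vmul : left_inverse (pi [::]) cinv cmul.
Proof.
move=> a; apply/curly_piP; apply: cr_trans (curly_rel_flip (repr a)).
exact: curly_rel_cat (curly_repr _) (cr_refl _).
Qed.

Lemma curly_mulV : right_inverse (pi [::]) cinv cmul.
Proof.
have flipK w : flip (flip w) = w.
  rewrite /flip map_rev revK -map_comp map_id_in // => -[[x y] e] _ /=.
  by rewrite negbK.
move=> a; apply/curly_piP; apply: cr_trans (curly_rel_flip (flip (repr a))).
by rewrite flipK; apply: curly_rel_cat (cr_refl _) (curly_repr _).
Qed.

HB.instance Definition _ := isGroup.Build curly_square
  curly_mulA curly_mul1 curly_1mul curly_Vmul curly_mulV.

Definition curly_wedge (x y : gT) : curly_square := pi [:: (x, y, false)].

Lemma curly_mulE u v : pi u * pi v = pi (u ++ v).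
Proof. by apply/curly_piP/curly_rel_cat; apply: curly_repr. Qed.

Lemma curly_wedge_pairing : curly_pairing curly_wedge.
Proof.
split=> [x y z | x y z | a b cab].
- by rewrite curly_mulE; apply/curly_piP/cr_left.
- by rewrite curly_mulE; apply/curly_piP/cr_right.
- exact/curly_piP/cr_comm.
Qed.

Lemma curly_wedge_eval w : pairing_eval curly_wedge w = pi w.
Proof.
elim: w => [|[[x y] e] w IHw] //=; rewrite IHw.
have -> : (if e then (curly_wedge x y)^-1 else curly_wedge x y) = pi [:: (x, y, e)].
  case: e => //; apply: mulg1_eq; rewrite curly_mulE.
  exact/curly_piP/(cr_free x y false).
by rewrite curly_mulE.
Qed.

Lemma commg_pairing : curly_pairing (fun x y : gT => [~ x, y]).
Proof.
split=> [x y z | x y z | a b cab]; last exact/eqP/commgP.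
  by rewrite commMgJ conjRg.
by rewrite commgMJ conjRg.
Qed.

(** In the normal form of a kernel element, [[~ a, s]] is the inverse of a product of commutators of
    [H], so it is trivial and the wedge of [a] and [s] vanishes. What remains is a word in [H]. *)
Lemma B0_trivial_normal_form (H : {group gT}) (s : gT) :
    (forall h g, h \in H -> h ^ g \in H) ->
    (forall g, exists2 h, h \in H & exists j, g = h * s ^+ j) ->
    (forall h k g, h \in H -> k \in H -> commute [~ h, k] g) ->
    (forall h, h \in H -> [~ h, s] \in [~: H, H] -> [~ h, s] = 1) ->
    abelian H \/ prime #|[~: H, H]| ->
  B0_trivial gT.
Proof.
move=> nHG genG cHH cHs oH' w w1.
(* Joining the wedge and the commutator into one pairing gives a single [a] and [v] for both
   components. *)
pose T (x y : gT) : curly_square * gT := (curly_wedge x y, [~ x, y]).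
have Tp : curly_pairing T.
  have [l1 r1 c1] := curly_wedge_pairing; have [l2 r2 c2] := commg_pairing.
  split=> [x y z | x y z | a b cab].
  - exact: f_equal2 (l1 x y z) (l2 x y z).
  - exact: f_equal2 (r1 x y z) (r2 x y z).
  - exact: f_equal2 (c1 a b cab) (c2 a b cab).
have TE v : pairing_eval T v = (pi v, curly_eval v).
  rewrite -curly_wedge_eval; elim: v => //= -[[x y] e] v ->.
  by case: e.
have [a Ha [v Hv]] := in_form_eval Tp nHG genG cHH w.
rewrite !TE w1 => -[Ew E1].
have Hcv : curly_eval v \in [~: H, H].
  elim: v Hv {Ew E1} => [|[[h k] e] v IHv] //= /andP[/andP[/= Hh Hk] Hv].
  by rewrite groupM ?IHv //; case: e; rewrite ?groupV mem_commg.
have as1 : [~ a, s] = 1.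
  by apply: cHs => //; rewrite -[[~ a, s]]invgK groupV (mulg1_eq (esym E1)).
apply/curly_piP; rewrite Ew /= -curly_wedge_eval.
have [_ _ ->] := curly_wedge_pairing; last exact/commgP/eqP.
rewrite as1 mul1g in E1; rewrite mul1g.
case: oH' => [abH | p_pr]; last first.
  exact: (pairing_eval_prime curly_wedge_pairing cHH p_pr erefl Hv).
have [_ _ wc] := curly_wedge_pairing.
elim: v Hv {Hcv Ew E1} => [|[[h k] e] v IHv] //= /andP[/andP[/= Hh Hk] Hv].
rewrite IHv // mulg1 wc ?invg1; last exact: (centsP abH).
by case: e.
Qed.

End CurlySquare.

(** * Commutators divided by [s - 1] *)

Section DividedCommutator.
Variables (gT : finGroupType) (A : {group gT}) (s : gT) (p : nat) (e : gT -> nat).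
Hypothesis nA : forall a g, a \in A -> a ^ g \in A.
Hypothesis abA : abelian A.
Hypothesis sAp : forall a, a \in A -> (s * a) ^+ p = 1.
Hypothesis eM : forall x y, e (x * y) = e x + e y %[mod p].
Hypothesis eA : forall x, s ^- e x * x \in A.

Let cA a b : a \in A -> b \in A -> a * b = b * a.
Proof. by move=> Aa Ab; apply: (centsP abA). Qed.

Let cACA a b c d : b \in A -> c \in A -> (a * b) * (c * d) = (a * c) * (b * d).
Proof. by move=> Ab Ac; rewrite !mulgA -(mulgA a) (cA Ab Ac) !mulgA. Qed.

(* [geom i a] is the image of [a] under [1 + s + ... + s^(i-1)], where [s] acts
   on the abelian group [A] by conjugation. *)
Definition geom i a := s ^- i * (s * a) ^+ i.
Definition off_cycle x := s ^- e x * x.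
(* If [off_cycle] and [e] are read as the crossed homomorphisms [d] and [D] (with
   [D s = 1]), this is [d x * D y]; the alternation [d x * D y - d y * D x],
   multiplied by [s - 1], is the commutator of [x] and [y]. *)
Definition half_pairing x y := geom (e y) (off_cycle x).

Let sp : s ^+ p = 1.
Proof. by have := sAp (group1 A); rewrite mulg1. Qed.

Lemma geomD i j a : geom (i + j) a = geom i a ^ (s ^+ j) * geom j a.
Proof.
by rewrite /geom expgnDr invgM expgnDr conjgE !mulgA mulgK.
Qed.

Lemma geom1 a : geom 1 a = a.
Proof. by rewrite /geom !expg1 mulKg. Qed.

Lemma geom_in i a : a \in A -> geom i a \in A.
Proof.
move=> Aa; elim: i => [|i IHi]; first by rewrite /geom mulg1 invg1 group1.
by rewrite -addn1 geomD geom1 groupM ?nA.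
Qed.

Lemma geomM i a b : a \in A -> b \in A -> geom i (a * b) = geom i a * geom i b.
Proof.
move=> Aa Ab; elim: i => [|i IHi]; first by rewrite /geom !mulg1 invg1 mulg1.
by rewrite -addn1 !geomD !geom1 IHi conjMg cACA // nA // geom_in.
Qed.

Lemma geomJ i j a : geom i (a ^ (s ^+ j)) = geom i a ^ (s ^+ j).
Proof.
have ss : s ^ (s ^+ j) = s by rewrite conjgE -expgS expgSr mulKg.
have si : s ^- i ^ (s ^+ j) = s ^- i by rewrite conjVg conjXg ss.
by rewrite /geom conjMg si conjXg conjMg ss.
Qed.

Lemma geom_in_V i a : a \in A -> geom i a^-1 = (geom i a)^-1.
Proof.
move=> Aa; apply/esym/mulg1_eq; rewrite -geomM ?groupV // mulgV.
by rewrite /geom mulg1 mulVg.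
Qed.

Lemma geomC i j a : a \in A -> geom i (geom j a) = geom j (geom i a).
Proof.
move=> Aa; elim: j => [|j IHj]; first by rewrite /geom !invg1 !mulg1 mulVg.
rewrite -addn1 !geomD !geom1 geomM ?nA ?geom_in // -IHj.
by have := geomJ i 1 (geom j a); rewrite expg1 => ->.
Qed.

(** This is s^i - 1 = (1 + s + ... + s^(i-1)) (s - 1) on the module [A]. *)
Lemma commg_geom i a : a \in A -> [~ a, s ^+ i] = geom i [~ a, s].
Proof.
move=> Aa; elim: i => [|i IHi]; first by rewrite /geom commg1 invg1 mulg1.
have As : [~ a, s] \in A by rewrite groupM ?groupV ?nA.
rewrite -addn1 expgnDr commgMJ IHi geomD geom1 expg1.
by rewrite cA // nA // geom_in.
Qed.

Let s_mod i j : i = j %[mod p] -> s ^+ i = s ^+ j.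
Proof.
move=> ij; rewrite (divn_eq i p) (divn_eq j p) !expgnDr !(mulnC _ p) !expgnA.
by rewrite sp !expg1n ij.
Qed.

(** Since [e] is additive only modulo [p], geometric sums have to be periodic in their length; the
    vanishing of the norm provides this. *)
Let geom_mod i j a : a \in A -> i = j %[mod p] -> geom i a = geom j a.
Proof.
move=> Aa ij; rewrite /geom (s_mod ij); congr (_ * _).
rewrite (divn_eq i p) (divn_eq j p) !expgnDr !(mulnC _ p) !expgnA.
by rewrite sAp // !expg1n ij.
Qed.

Let actA a x : a \in A -> a ^ x = a ^ (s ^+ e x).
Proof.
move=> Aa; rewrite -{1}(mulKVg (s ^+ e x) x) conjgM conjgE.
by rewrite (cA (nA _ Aa) (eA x)) mulKg.
Qed.

Lemma half_in x y : half_pairing x y \in A.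
Proof. exact/geom_in/eA. Qed.

Lemma half_Mr x y z :
  half_pairing x (y * z) = half_pairing x y ^ z * half_pairing x z.
Proof.
by rewrite (actA _ (half_in _ _)) /half_pairing (geom_mod (eA x) (eM y z)) geomD.
Qed.

Lemma half_Ml x y z :
  half_pairing (x * y) z = half_pairing x z ^ y * half_pairing y z.
Proof.
rewrite (actA _ (half_in _ _)) /half_pairing -geomJ -geomM ?nA ?eA //.
congr geom; rewrite /off_cycle (s_mod (eM x y)) expgnDr invgM conjgE.
by rewrite !mulgA mulgK.
Qed.

(** Conjugating by [z] changes [off_cycle x] by a commutator of [s ^+ e x] with [off_cycle z],
    besides the action. By [commg_geom] the resulting correction is a double geometric sum, which
    [geomC] makes symmetric in [x] and [y]. *)
Lemma half_J x y z : half_pairing (x ^ z) (y ^ z) =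
  (geom (e y) (geom (e x) [~ off_cycle z, s]))^-1 * half_pairing x y ^ z.
Proof.
have eJ u : e (u ^ z) = e u %[mod p].
  have := eM z (u ^ z); rewrite -conjgC eM addnC => /eqP.
  by rewrite eqn_modDl => /eqP.
have Ad : off_cycle z \in A := eA z; set d := off_cycle z.
have As : [~ d, s] \in A by rewrite groupM ?groupV ?nA.
rewrite {1}/half_pairing (geom_mod (eA _) (eJ y)) (actA _ (half_in _ _)).
rewrite /half_pairing -geomJ -geom_in_V ?geom_in // -geomM ?groupV ?nA ?geom_in ?eA //.
congr geom; rewrite -commg_geom // invgR /off_cycle (s_mod (eJ x)).
set c := s ^+ e z; set b := s ^+ e x; have zE : z = c * d by rewrite mulKVg.
have xE : x = b * off_cycle x by rewrite mulKVg.
have bc : b ^ c = b.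
  by rewrite conjgE /b /c -expgnDr addnC expgnDr mulKg.
have od : (off_cycle x ^ c) ^ d = off_cycle x ^ c.
  have Ao : off_cycle x ^ c \in A by apply: nA (eA x).
  by rewrite [LHS]conjgE -[X in _^-1 * X](cA Ad Ao) mulKg.
have -> : x ^ z = b ^ d * off_cycle x ^ c.
  by rewrite [in LHS]zE conjgM {1}xE (conjMg b) bc conjMg od.
by rewrite mulgA.
Qed.

Lemma half_AA a b : e b = 0 %[mod p] -> half_pairing a b = 1.
Proof. by move=> eb; rewrite /half_pairing (geom_mod (eA a) eb) /geom !invg1 !mulg1. Qed.

Lemma half_As a : e a = 0 %[mod p] -> e s = 1 %[mod p] -> half_pairing a s = a.
Proof.
move=> ea es; rewrite /half_pairing (geom_mod (eA a) es) geom1 /off_cycle.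
by rewrite (s_mod ea) invg1 mul1g.
Qed.

End DividedCommutator.

(** * Alternating a half pairing *)

Section Alternation.
Variables (gT : finGroupType) (A : {group gT}) (g : gT -> gT -> gT).
Variable k : gT -> gT -> gT -> gT.
Hypothesis nA : forall a g, a \in A -> a ^ g \in A.
Hypothesis abA : abelian A.
Hypothesis half_in : forall x y, g x y \in A.
Hypothesis half_Mr : forall x y z, g x (y * z) = g x y ^ z * g x z.
Hypothesis half_Ml : forall x y z, g (x * y) z = g x z ^ y * g y z.
Hypothesis k_in : forall x y z, k x y z \in A.
Hypothesis k_sym : forall x y z, k x y z = k y x z.
Hypothesis half_J : forall x y z, g (x ^ z) (y ^ z) = (k x y z)^-1 * g x y ^ z.

Let cA a b : a \in A -> b \in A -> a * b = b * a.
Proof. by move=> Aa Ab; apply: (centsP abA). Qed.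

Let cACA a b c d : b \in A -> c \in A -> (a * b) * (c * d) = (a * c) * (b * d).
Proof. by move=> Ab Ac; rewrite !mulgA -(mulgA a) (cA Ab Ac) !mulgA. Qed.

Definition alternation x y := g x y * (g y x)^-1.

Lemma alternation_V x y : alternation y x = (alternation x y)^-1.
Proof. by rewrite /alternation invgM invgK. Qed.

Lemma alternation_xx x : alternation x x = 1.
Proof. by rewrite /alternation mulgV. Qed.

Lemma alternation_Mr x y z :
  alternation x (y * z) = alternation x z * alternation x y ^ z.
Proof.
rewrite /alternation half_Mr half_Ml invgM conjMg conjVg.
rewrite [X in _ * X]cA ?groupV ?nA ?half_in // cACA ?groupV ?nA ?half_in //.
by rewrite cA // groupM ?groupV ?nA ?half_in.
Qed.

Lemma alternation_Ml x y z :
  alternation (x * y) z = alternation x z ^ y * alternation y z.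
Proof.
rewrite alternation_V alternation_Mr invgM -conjVg -!alternation_V //.
Qed.

(** The correction [k] is symmetric, so it cancels between the two halves. *)
Lemma alternation_J x y z :
  alternation (x ^ z) (y ^ z) = alternation x y ^ z.
Proof.
rewrite /alternation !half_J (k_sym y) conjMg conjVg invgM invgK.
have Ak := k_in x y z.
rewrite [X in _ * X = _](cA _ Ak) ?groupV ?nA ?half_in // cACA ?nA ?half_in //.
by rewrite mulVg mul1g.
Qed.

Lemma alternation_X x j : alternation x (x ^+ j) = 1.
Proof.
elim: j => [|j IHj]; last by rewrite expgS alternation_Mr IHj alternation_xx conj1g mulg1.
have := alternation_Mr x 1 1; rewrite mulg1 conjg1 => /eqP.
by rewrite -{1}[alternation x 1]mulg1 (inj_eq (mulgI _)) => /eqP.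
Qed.

End Alternation.

(** * Detecting a non-trivial multiplier *)

Section CosetT.
Variables (gT : finGroupType) (N : {group gT}).
Hypothesis nN : [set: gT] \subset 'N(N).
Let inN x : x \in 'N(N). Proof. exact: (subsetP nN). Qed.

Lemma cosetM x y : coset N (x * y) = coset N x * coset N y.
Proof. exact: morphM. Qed.
Lemma cosetV x : coset N x^-1 = (coset N x)^-1.
Proof. exact: morphV. Qed.
Lemma cosetX x i : coset N (x ^+ i) = coset N x ^+ i.
Proof. exact: morphX. Qed.
Lemma cosetJ x y : coset N (x ^ y) = coset N x ^ coset N y.
Proof. exact: morphJ. Qed.
Lemma cosetR x y : coset N [~ x, y] = [~ coset N x, coset N y].
Proof. exact: morphR. Qed.
Lemma coset1P x : (coset N x == 1) = (x \in N).
Proof. by apply/eqP/idP => [/coset_idr -> // | /coset_id]. Qed.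
Lemma coset_mem (A : {group gT}) x : N \subset A -> (coset N x \in A / N) = (x \in A).
Proof.
move=> sNA; apply/idP/idP => [/morphimP[y Ny Ay /eqP] | Ax]; last exact: mem_quotient.
rewrite -/(coset N x) -(inj_eq (mulIg (coset N y)^-1)) mulgV -cosetV -cosetM coset1P.
by move/(subsetP sNA); rewrite groupMr // groupV.
Qed.
Lemma coset_surj q : exists x, q = coset N x.
Proof. by case: (cosetP q) => x; exists x. Qed.
End CosetT.

(** * The divided commutator modulo the derived subgroup *)

Section NontrivialMultiplier.
Variables (gT : finGroupType) (H : {group gT}) (p : nat) (s a : gT).
Hypothesis p_pr : prime p.
Hypothesis nH : [set: gT] \subset 'N(H).
Hypothesis iH : #|[set: gT] : H| = p.
Hypothesis sH : s \notin H.
Hypothesis cHx : forall x h, x \notin H -> h \in H -> commute h x -> h \in [~: H, H].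
Hypothesis Ha : a \in H.
Hypothesis aM : a \notin [~: H, H].
Hypothesis asM : [~ a, s] \in [~: H, H].

Let M := [~: H, H].
Let sMH : M \subset H. Proof. exact: (der_sub 1 H). Qed.
Let nM : [set: gT] \subset 'N(M).
Proof. exact: char_norm_trans (der_char 1 H) nH. Qed.

Let oGH : #|[set: gT] / H| = p. Proof. by rewrite card_quotient. Qed.

Let order_coset x : x \notin H -> #[coset H x] = p.
Proof.
move=> xH; have := order_dvdG (mem_quotient H (in_setT x)); rewrite oGH.
by case/(primeP p_pr).2/orP => /eqP //; move/eqP; rewrite order_eq1 coset1P // (negPf xH).
Qed.

Let coset_pow x y : x \notin H -> exists j, coset H y == coset H x ^+ j.
Proof.
move=> xH; have /cycleP[j ->] : coset H y \in <[coset H x]>; last by exists j.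
have -> : <[coset H x]> = [set: gT] / H; last exact: mem_quotient.
by apply/eqP; rewrite eqEcard cycle_subG mem_quotient //= oGH -orderE order_coset.
Qed.

(** A representative of the image of [x] in G / H, identified with the integers modulo [p] by
    sending [s] to 1. *)
Let e x := ex_minn (coset_pow x sH).
Let eP x : coset H x = coset H s ^+ e x.
Proof. by rewrite /e; case: ex_minnP => j /eqP. Qed.

Let e_eq x i : coset H x = coset H s ^+ i -> e x = i %[mod p].
Proof. by rewrite eP => /eqP; rewrite eq_expg_mod_order order_coset // => /eqP. Qed.

Let A := (H / M)%G.
Let eb (q : coset_of M) := e (fingroup.repr q).

Let e_coset x y : coset M x = coset M y -> e x = e y %[mod p].
Proof.
move=> /eqP exy; apply: e_eq; rewrite -eP; apply/eqP.
rewrite -(inj_eq (mulIg (coset H y)^-1)) mulgV -cosetV // -cosetM // coset1P //.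
apply: (subsetP sMH); rewrite -/M -coset1P // cosetM // cosetV //.
by rewrite (eqP exy) mulgV.
Qed.

Let ebE x : eb (coset M x) = e x %[mod p].
Proof. by apply: e_coset; rewrite coset_reprK. Qed.

Let eb_M q r : eb (q * r) = eb q + eb r %[mod p].
Proof.
have [x ->] := coset_surj q; have [y ->] := coset_surj r.
rewrite -cosetM // ebE -[RHS]modnDm (ebE x) (ebE y) modnDm; apply: e_eq.
by rewrite cosetM // (eP x) (eP y) expgnDr.
Qed.

Let eb_A q : coset M s ^- eb q * q \in A.
Proof.
have [x ->] := coset_surj q; have := ebE x; set i := eb _ => Ei.
rewrite -cosetX // -cosetV // -cosetM // coset_mem // -coset1P //.
rewrite cosetM // cosetV // cosetX // (eP x).
rewrite -eq_invg_mul invgK eq_expg_mod_order order_coset //.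
by rewrite Ei.
Qed.

Let nA : forall q r, q \in A -> q ^ r \in A.
Proof.
move=> q r Aq; have [y ->] := coset_surj r.
by rewrite memJ_norm // (subsetP (quotient_norms _ nH)) // mem_quotient.
Qed.

Let abA : abelian A.
Proof. exact: (sub_der1_abelian (subxx M)). Qed.

Let power_in x : x \notin H -> x ^+ p \in M.
Proof.
move=> xH; apply: (cHx xH); last exact/commute_sym/commuteX/commute_refl.
by rewrite -coset1P // cosetX // -(order_coset xH) expg_order.
Qed.

Let sAp q : q \in A -> (coset M s * q) ^+ p = 1.
Proof.
case/morphimP=> h _ Hh ->; rewrite -/(coset M h) -cosetM // -cosetX //.
by apply/eqP; rewrite coset1P // power_in // groupMr.
Qed.

Let g := half_pairing (coset M s) eb.
Let T x y := alternation g (coset M x) (coset M y).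

Let g_in x y : g x y \in A. Proof. exact: half_in. Qed.
Let g_Mr x y z : g x (y * z) = g x y ^ z * g x z.
Proof. exact: (half_Mr nA abA sAp). Qed.
Let g_Ml x y z : g (x * y) z = g x z ^ y * g y z.
Proof. exact: (half_Ml nA abA sAp). Qed.
Let k x y z := geom (coset M s) (eb y)
  (geom (coset M s) (eb x) [~ off_cycle (coset M s) eb z, coset M s]).
Let k_aux z : [~ off_cycle (coset M s) eb z, coset M s] \in A.
Proof. by rewrite groupM ?groupV ?nA // eb_A. Qed.
Let k_in x y z : k x y z \in A.
Proof. by rewrite !geom_in. Qed.
Let k_sym x y z : k x y z = k y x z.
Proof. exact: (geomC _ nA abA _ _ (k_aux z)). Qed.
Let g_J x y z : g (x ^ z) (y ^ z) = (k x y z)^-1 * g x y ^ z.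
Proof. exact: (half_J nA abA sAp). Qed.

(** If [u] lies outside [H], anything commuting with it is a power of [u] times an element of [H]
    commuting with [u], hence a power of [u] modulo [M]. For two elements of [H] both halves vanish,
    their exponents being 0. *)
Let T_comm x y : commute x y -> T x y = 1.
Proof.
have TX u v : u \notin H -> commute u v -> T u v = 1.
  move=> uH cuv; have [j /eqP Ej] := coset_pow v uH.
  rewrite /T; suff -> : coset M v = coset M u ^+ j by exact: (alternation_X nA abA g_in g_Mr g_Ml).
  have Hd : u ^- j * v \in M.
    apply: (cHx uH); first by rewrite -coset1P // cosetM // cosetV // cosetX // Ej mulVg.
    apply: commute_sym; apply: commuteM => //; apply: commuteV; exact/commuteX/commute_refl.
  by rewrite -{1}(mulKVg (u ^+ j) v) cosetM // cosetX // (eqP (etrans (coset1P nM _) Hd)) mulg1.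
move=> cxy; have [Hx | ] := boolP (x \in H); last by move/TX; apply.
have [Hy | yH] := boolP (y \in H); last first.
  have -> : T x y = (T y x)^-1 by apply: alternation_V.
  by rewrite TX ?invg1 //; apply: commute_sym.
have half1 u v : v \in H -> g (coset M u) (coset M v) = 1.
  move=> Hv; apply: (half_AA sAp eb_A); rewrite ebE; apply: e_eq; apply/eqP.
  by rewrite coset1P.
by rewrite /T /alternation !half1 // invg1 mulg1.
Qed.

Let T_pairing : curly_pairing T.
Proof.
split=> [x y z | x y z | x y]; last exact: T_comm.
  by rewrite /T !cosetJ // (alternation_J nA abA g_in k_in k_sym g_J) cosetM //
             (alternation_Ml nA abA g_in g_Mr g_Ml).
by rewrite /T !cosetJ // (alternation_J nA abA g_in k_in k_sym g_J) cosetM //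
           (alternation_Mr nA abA g_in g_Mr g_Ml).
Qed.

Lemma B0_nontrivial : ~ B0_trivial gT.
Proof.
move=> B0; have Te w : curly_eval w = 1 -> pairing_eval T w = 1.
  by move/B0/(pairing_eval_curly_rel T_pairing).
have T_H u v : u \in H -> v \in H -> T u v = 1.
  have half1 x y : y \in H -> g (coset M x) (coset M y) = 1.
    move=> Hy; apply: (half_AA sAp eb_A); rewrite ebE; apply: e_eq; apply/eqP.
    by rewrite coset1P.
  by move=> Hu Hv; rewrite /T /alternation !half1 // invg1 mulg1.
have T_as : T a s = coset M a.
  have ea : eb (coset M a) = 0 %[mod p].
    by rewrite ebE; apply: e_eq; apply/eqP; rewrite coset1P.
  have es : eb (coset M s) = 1 %[mod p] by rewrite ebE; apply: e_eq.
  by rewrite /T /alternation /g (half_As sAp eb_A ea es) (half_AA sAp eb_A _ ea) invg1 mulg1.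
have [v Ev Tv] : exists2 v, curly_eval v = [~ a, s] & pairing_eval T v = 1.
  have /gen_prodgP[m [c cH ->]] := asM.
  elim: m c cH => [|m IHm] c cH; first by exists [::]; rewrite ?big_ord0.
  have [v Ev Tv] := IHm _ (fun i => cH (lift ord0 i)).
  have /imset2P[u u' Hu Hu' Ec] := cH ord0.
  exists ((u, u', false) :: v); first by rewrite /= Ev big_ord_recl Ec.
  by rewrite /= Tv T_H ?mulg1.
(* This word evaluates to 1, whereas [T] sends it to the inverse of [coset M a]. *)
have := Te ((a, s, true) :: v); rewrite /= Ev mulVg Tv mulg1 T_as => /(_ erefl) /eqP.
by rewrite invg_eq1 coset1P // (negPf aM).
Qed.

End NontrivialMultiplier.

(** * Groups of maximal class *)

Lemma central_commM (gT : finGroupType) (K : {group gT}) a b c d :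
    (forall u v g, u \in K -> v \in K -> g \in K -> commute [~ u, v] g) ->
    a \in K -> b \in K -> c \in K -> d \in K ->
  [~ a * b, c * d] = [~ a, c] * [~ a, d] * ([~ b, c] * [~ b, d]).
Proof.
move=> cK Ka Kb Kc Kd.
have mr u v w : u \in K -> v \in K -> w \in K -> [~ u, v * w] = [~ u, v] * [~ u, w].
  move=> Ku Kv Kw; have c1 : commute [~ u, v] w by apply: cK.
  rewrite commgMJ [_ ^ w]conjgE c1 mulKg; apply: cK => //.
  by rewrite groupM ?groupV ?groupJ.
have c2 : commute [~ a, c * d] b by apply: cK; rewrite ?groupM.
by rewrite commMgJ [_ ^ b]conjgE c2 mulKg !mr.
Qed.

(* On a cyclic group of order [p], [1 + E] raised to the power [p] is [1 + E^p]. *)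
Lemma binomial_shift (gT : finGroupType) (w : gT) (f : nat -> nat -> gT) p i :
    prime p -> w ^+ p = 1 -> (forall i, f i 0 \in <[w]>) ->
    (forall i j, f i j.+1 = f i j * f i.+1 j) ->
  f i p = f i 0 * f (i + p)%N 0.
Proof.
move=> p_pr wp wf fS.
have exr l : exists r, f l 0 == w ^+ r.
  by have /cycleP[r ->] := wf l; exists r.
pose r l := ex_minn (exr l).
have fr l : f l 0 = w ^+ r l by rewrite /r; case: ex_minnP => m /eqP.
have fE j : forall l, f l j = w ^+ (\sum_(m < j.+1) 'C(j, m) * r (l + m)).
  elim: j => [|j IHj] l; first by rewrite big_ord1 bin0 mul1n addn0 fr.
  rewrite fS !IHj -expgnDr; congr (_ ^+ _).
  rewrite [RHS]big_ord_recl [X in (X + _)%N]big_ord_recl !bin0 -addnA; congr addn.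
  have -> : \sum_(m < j.+1) 'C(j.+1, bump 0 m) * r (l + bump 0 m) =
     (\sum_(m < j.+1) 'C(j, m.+1) * r (l + m.+1) + \sum_(m < j.+1) 'C(j, m) * r (l.+1 + m))%N.
    by rewrite -big_split; apply: eq_bigr => m _; rewrite /= binS mulnDl addSnnS.
  by congr (_ + _)%N; rewrite [RHS]big_ord_recr /= bin_small // mul0n addn0.
rewrite fE !fr; case: p p_pr wp => // q p_pr wq.
rewrite big_ord_recl big_ord_recr /= bin0 binn !mul1n addn0 -expgnDr !expgnDr.
congr (_ * _); rewrite -[RHS]mul1g; congr (_ * _).
have /dvdnP[c ->] : (q.+1 %| \sum_(m < q) 'C(q.+1, bump 0 m) * r (i + bump 0 m))%N.
  by apply: dvdn_sum => m _; apply: dvdn_mulr; apply: prime_dvd_bin; rewrite //= ltnS ltn_ord.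
by rewrite mulnC expgnA wq expg1n.
Qed.

Lemma three_subgroup_sub (gT : finGroupType) (A B C N : {group gT}) :
    A \subset 'N(N) -> B \subset 'N(N) -> C \subset 'N(N) ->
    [~: A, B, C] \subset N -> [~: B, C, A] \subset N -> [~: C, A, B] \subset N.
Proof.
move=> nA nB nC.
have qR (X Y Z : {group gT}) : X \subset 'N(N) -> Y \subset 'N(N) -> Z \subset 'N(N) ->
    ([~: X, Y, Z] \subset N) = ([~: X / N, Y / N, Z / N] == 1).
  move=> nX nY nZ; have nXY : [~: X, Y] \subset 'N(N) by rewrite comm_subG.
  by rewrite -!quotientR // -subG1 quotient_sub1 // comm_subG.
rewrite !qR // => /eqP h1 /eqP h2; apply/eqP; exact: three_subgroup h1 h2.
Qed.

(** Induction on [j]: the next term is a commutator with [G], and the three subgroup lemma is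
    applied modulo the target. *)
Lemma lcn_comm (gT : finGroupType) (G : {group gT}) i j :
  [~: 'L_i.+1(G), 'L_j.+1(G)] \subset 'L_(i + j).+2(G).
Proof.
elim: j i => [|j IHj] i; first by rewrite addn0.
have nN k : 'L_k(G) \subset 'N('L_(i + j.+1).+2(G)).
  exact: subset_trans (lcn_sub k G) (lcn_norm _ _).
rewrite commGC lcnSn; apply: three_subgroup_sub; rewrite ?nN ?lcn_norm //.
  by rewrite (commGC G) -lcnSn addnS -addSn IHj.
by rewrite addnS; apply: commSg; apply: IHj.
Qed.

(** The intersection of [X] and [W] lies between [Y] and [X], so it is one of them, and [u] excludes
    [Y]. *)
Lemma prime_index_gen (gT : finGroupType) (X Y W : {group gT}) u :
  Y \subset X -> prime #|X : Y| -> u \in X -> u \notin Y -> u \in W -> Y \subset W ->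
  X \subset W.
Proof.
move=> sYX pXY Xu Yu Wu sYW.
have sYI : Y \subset X :&: W by rewrite subsetI sYX.
have := Lagrange_index (subsetIl X W) sYI => E.
have : (#|X : X :&: W| %| #|X : Y|)%N by rewrite -E dvdn_mulr.
case/(primeP pXY).2/orP => /eqP Ei.
  by move/eqP: Ei; rewrite indexg_eq1 subsetI => /andP[].
move: E; rewrite Ei -[RHS]muln1 => /eqP; rewrite eqn_pmul2l ?prime_gt0 //.
rewrite indexg_eq1 => /subsetP/(_ u); rewrite inE Xu Wu => /(_ isT) Yu'.
by rewrite Yu' in Yu.
Qed.

Section MaximalClass.
Variables (gT : finGroupType) (p n : nat).
Hypothesis p_pr : prime p.
Hypothesis n_ge4 : (4 <= n)%N.
Notation G := [set: gT].
Hypothesis oG : #|G| = (p ^ n)%N.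
Hypothesis clG : nil_class G = n.-1.

Let pG : p.-group G. Proof. by rewrite /pgroup oG pnatX pnat_id. Qed.
Let nilG : nilpotent G. Proof. exact: pgroup_nil pG. Qed.

Let n_gt0 : (0 < n)%N. Proof. exact: leq_trans n_ge4. Qed.
Let p_gt1 : (1 < p)%N. Proof. exact: prime_gt1. Qed.

(** * Orders in the lower central series and two-step centralizers *)

Lemma lcn_n : 'L_n(G) = 1.
Proof.
have /(lcn_nil_classP _ nilG) := leqnn (nil_class G).
by rewrite clG prednK.
Qed.

Lemma lcn_neq1 i : (0 < i < n)%N -> 'L_i(G) != 1.
Proof.
case: i => // i /= lt_in; apply: contraTneq lt_in => /(lcn_nil_classP _ nilG).
by rewrite clG -leqNgt -(leq_add2r 1) !addn1 prednK.
Qed.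

Let lcn_card_exp i : exists a, #|'L_i(G)| = (p ^ a)%N.
Proof. by case/p_natP: (pgroupS (lcn_sub i G) pG) => a; exists a. Qed.

Let lcn_exp_lt i a b : (0 < i < n)%N -> #|'L_i(G)| = (p ^ a)%N ->
  #|'L_i.+1(G)| = (p ^ b)%N -> (b < a)%N.
Proof.
move=> i_n Ea Eb; have : 'L_i.+1(G) \proper 'L_i(G).
  case: i i_n {Ea Eb} => // i i_n; rewrite lcnSn.
  by apply: (nil_comm_properl nilG); rewrite ?lcn_sub ?lcn_neq1 // subsetI subxx lcn_norm.
by move/proper_card; rewrite Ea Eb ltn_exp2l.
Qed.

Lemma card_lcn i : (1 < i <= n)%N -> #|'L_i(G)| = (p ^ (n - i))%N.
Proof.
have lower j a : (j < n)%N -> #|'L_(n - j)(G)| = (p ^ a)%N -> (j <= a)%N.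
  elim: j a => // j IHj a lt_jn Ea; have [b Eb] := lcn_card_exp (n - j).
  apply: leq_ltn_trans (IHj b (ltnW lt_jn) Eb) _.
  have e : (n - j = (n - j.+1).+1)%N by rewrite subnSK // ltnW.
  rewrite e in Eb; apply: lcn_exp_lt Ea Eb.
  by rewrite subn_gt0 lt_jn ltn_subrL n_gt0.
have upper j a : (j.+2 <= n)%N -> #|'L_j.+2(G)| = (p ^ a)%N -> (a <= n - j.+2)%N.
  elim: j a => [|j IHj] a le_jn Ea; last first.
    have [b Eb] := lcn_card_exp j.+2.
    have lt_ab : (a < b)%N by apply: lcn_exp_lt Eb Ea.
    have := IHj b (ltnW le_jn) Eb; lia.
  have oQ : #|G / 'L_2(G)| = (p ^ (n - a))%N.
    rewrite card_quotient ?lcn_norm // -divgS ?lcn_sub // oG Ea -expnB ?prime_gt0 //.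
    by rewrite -(leq_exp2l _ _ p_gt1) -oG -Ea subset_leq_card ?lcn_sub.
  rewrite leqNgt; apply/negP => lt_na.
  have cQ : cyclic (G / 'L_2(G)).
    have : (n - a <= 1)%N by lia.
    case: (n - a)%N oQ => [|[|//]] oQ _.
      by rewrite (card1_trivg oQ) cyclic1.
    by rewrite prime_cyclic // oQ expn1.
  have := cyclic_abelian (cyclic_nilpotent_quo_der1_cyclic nilG cQ).
  move/derG1P => /eqP; apply/negP; apply: (@lcn_neq1 2).
  by rewrite /= (leq_trans _ n_ge4).
case: i => [|[|i]] // /= le_in; have [a Ea] := lcn_card_exp i.+2.
rewrite Ea; congr expn; apply/eqP; rewrite eqn_leq upper //=.
by apply: lower; rewrite ?subKn // ltn_subrL n_gt0.
Qed.

Lemma index_lcn i : (1 < i < n)%N -> #|'L_i(G) : 'L_i.+1(G)| = p.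
Proof.
move=> i_n; have e1 : (1 < i <= n)%N by lia.
have e2 : (1 < i.+1 <= n)%N by lia.
rewrite -divgS ?lcn_subS // (card_lcn e1) (card_lcn e2) -expnB ?prime_gt0 //; last lia.
by rewrite -[RHS]expn1; congr expn; lia.
Qed.

(** The two-step centralizer C_G(P_i / P_(i+2)); for [i] = 2 it is convertible with [P1]. *)
Definition two_step i : {set gT} :=
  G :&: coset 'L_i.+2(G) @*^-1 'C('L_i(G) / 'L_i.+2(G)).
Canonical two_step_group i := [group of two_step i].

Lemma sub_two_step (A : {set gT}) i :
  (A \subset two_step i) = ([~: A, 'L_i(G)] \subset 'L_i.+2(G)).
Proof.
have nA (B : {set gT}) : B \subset 'N('L_i.+2(G)).
  exact: subset_trans (subsetT B) (lcn_norm _ _).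
by rewrite subsetI subsetT -sub_quotient_pre ?nA // quotient_cents2 ?nA.
Qed.

Lemma in_two_step x i : (x \in two_step i) =
  (coset 'L_i.+2(G) x \in 'C('L_i(G) / 'L_i.+2(G))).
Proof.
rewrite inE in_setT /=; apply/morphpreP/idP => [[] // | cx]; split=> //.
exact: (subsetP (lcn_norm _ _)).
Qed.

Lemma lcn_gen i u (W : {group gT}) : (1 < i < n)%N ->
  u \in 'L_i(G) -> u \notin 'L_i.+1(G) -> u \in W -> 'L_i.+1(G) \subset W -> 'L_i(G) \subset W.
Proof.
by move=> i_n; apply: prime_index_gen; rewrite ?lcn_subS // index_lcn.
Qed.

Lemma lcn_ex i : (1 < i < n)%N -> exists2 u, u \in 'L_i(G) & u \notin 'L_i.+1(G).
Proof.
move=> i_n; apply/subsetPn; rewrite -indexg_eq1 index_lcn //.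
by rewrite neq_ltn prime_gt1 ?orbT.
Qed.

(** The index counts the conjugates of a generator [u] of ['L_i(G)] modulo ['L_i.+2(G)]. They lie in
    one coset of a group of order [p], and their number is a power of [p] other than 1. *)
Lemma index_two_step i : (1 < i)%N -> (i.+2 <= n)%N -> #|G : two_step i| = p.
Proof.
move=> i1 i_n; set N := 'L_i.+2(G)%G.
have nN : G \subset 'N(N) by apply: lcn_norm.
have [u Lu Lu'] : exists2 u, u \in 'L_i(G) & u \notin 'L_i.+1(G) by apply: lcn_ex; lia.
have inK x : (x \in two_step i) = (coset N x \in 'C[coset N u]).
  rewrite in_two_step; apply/idP/idP=> [/centP cx | cx].
    by apply/cent1P/cx; apply: mem_quotient.
  rewrite -sub_cent1 -[_ / _]/('L_i(G) / N) sub_quotient_pre; last first.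
    exact: subset_trans (subsetT _) nN.
  apply: (@lcn_gen i u [group of coset N @*^-1 'C[coset N x]]) => //; first lia.
    by rewrite mem_morphpre ?(subsetP nN) // cent1C.
  rewrite -sub_quotient_pre; last exact: subset_trans (subsetT _) nN.
  rewrite sub_cent1; have := subset_trans (lcn_central i.+1 G) (subsetIr _ _).
  by rewrite centsC => /subsetP; apply; apply: mem_quotient.
have sNK : N \subset two_step i.
  by rewrite sub_two_step commg_subl (subset_trans (subsetT _)).
have Ei : #|G : two_step i| = #|coset N u ^: (G / N)|.
  rewrite -index_cent1 -(index_quotient_eq (H := N)) ?subsetT ?setTI //.
  congr #|_ : _|; apply/setP=> q; have [x ->] := coset_surj q.
  by rewrite coset_mem // inK [RHS]in_setI mem_quotient ?in_setT.
have le_p : (#|G : two_step i| <= p)%N.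
  have e : (1 < i.+1 < n)%N by lia.
  have oL : #|'L_i.+1(G) / N| = p.
    by rewrite card_quotient ?index_lcn // (subset_trans (subsetT _)).
  rewrite Ei -oL -(card_lcoset ('L_i.+1(G) / N) (coset N u)) subset_leq_card //.
  apply/subsetP => y /imsetP[q _ ->{y}]; have [x ->] := coset_surj q.
  rewrite mem_lcoset -commgEl -cosetR // mem_quotient //.
  by apply: (subsetP (lcnSnS i G)); apply: mem_commg.
have ne1 : #|G : two_step i| != 1%N.
  have e : (1 < i.+1 < n)%N by lia.
  have eL : [~: 'L_i(G), G] = 'L_i.+1(G) by case: (i) i1.
  rewrite indexg_eq1 sub_two_step commGC eL -indexg_eq1 index_lcn //.
  by rewrite neq_ltn prime_gt1 ?orbT.
have /p_natP[[|k] Ek] : p.-nat #|G : two_step i|.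
- by apply: pnat_dvd pG; apply: dvdn_indexg.
- by rewrite Ek in ne1.
by move: le_p; rewrite Ek -{2}(expn1 p) leq_exp2l ?prime_gt1 // ltnS leqn0 => /eqP->.
Qed.

(** Take the last term ['L_m.+2(G)] containing [N]. An element of [N] outside the next term gives
    ['L_i(G) \subset N <*> 'L_i.+1(G)] for [i] = [m.+2], and commuting with [G] carries this to all
    larger [i]. The terms are then absorbed into [N] from ['L_n(G)] = 1 upwards. *)
Lemma normal_lcn (N : {group gT}) : N <| G -> N \subset 'L_2(G) ->
  exists2 m, (1 < m <= n)%N & N :=: 'L_m(G).
Proof.
move=> nN sN2; have [sN1 | nsN] := boolP (N \subset 'L_n(G)).
  exists n; first lia.
  by apply/eqP; rewrite eqEsubset sN1 lcn_n sub1G.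
have exm : exists m, ~~ (N \subset 'L_m(G)) by exists n.
case: (ex_minnP exm) => m nsm minm.
have m_n : (m <= n)%N by apply: minm.
case: m nsm minm m_n => [|[|[|m]]] nsm minm m_n; rewrite ?subsetT ?sN2 // in nsm.
have sNm : N \subset 'L_m.+2(G).
  by have [// | /minm] := boolP (N \subset 'L_m.+2(G)); rewrite ltnn.
exists m.+2; first by move: m_n; clear; lia.
apply/eqP; rewrite eqEsubset sNm /=.
have nT (K : {group gT}) : K <| G -> G \subset 'N(K) by case/andP.
have step i : (m.+2 <= i < n)%N -> 'L_i(G) \subset N <*> 'L_i.+1(G).
  elim: i => // i IHi i_n; have [ei | ne] := eqVneq i m.+1.
    rewrite ei in i_n *.
    have /subsetPn[u Nu Lu] := nsm.
    apply: (lcn_gen (u := u)); rewrite ?joing_subr ?(subsetP sNm) //.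
    by apply: (subsetP (joing_subl _ _)).
  have {}IHi : 'L_i(G) \subset N <*> 'L_i.+1(G) by apply: IHi; move: i_n ne; clear; lia.
  case: i IHi i_n ne => [|i] IHi i_n ne; first by move: i_n; clear; lia.
  rewrite lcnSn; apply: subset_trans (commSg G IHi) _.
  set W := (N <*> 'L_i.+3(G))%G.
  have nW : G \subset 'N(W) by rewrite normsY ?(nT _ nN) ?lcn_norm.
  have nWs (B : {set gT}) : B \subset 'N(W) by apply: subset_trans (subsetT B) nW.
  have cW (K : {group gT}) : ([~: K, G] \subset W) = (K \subset coset W @*^-1 'C(G / W)).
    by rewrite -sub_quotient_pre ?quotient_cents2.
  rewrite -[_ <*> _]/(gval (N <*> 'L_i.+2(G))%G) cW join_subG -!cW.
  rewrite (subset_trans _ (joing_subl _ _)) ?commg_subl ?(nT _ nN) //=.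
  by rewrite (subset_trans (lcnSnS _ _) (joing_subr _ _)).
have down j : (j <= n - m.+2)%N -> 'L_(n - j)(G) \subset N.
  elim: j => [|j IHj] j_n; first by rewrite subn0 lcn_n sub1G.
  have e : (n - j = (n - j.+1).+1)%N by move: j_n; clear; lia.
  apply: subset_trans (step _ _) _; first by move: j_n m_n; clear; lia.
  by rewrite join_subG subxx -e IHj //; move: j_n; clear; lia.
by have := down (n - m.+2)%N (leqnn _); rewrite subKn // ltnW.
Qed.

(** * Commutation modulo a normal subgroup *)

Section CommutatorModulo.
Variable N : {group gT}.
Hypothesis nN : G \subset 'N(N).

(** The elements whose commutators with [B] fall in [N]. As this is a group, such conditions can be
    checked on generators. *)
Definition centmod (B : {set gT}) := [group of coset N @*^-1 'C(B / N)].

Lemma sub_centmod (A B : {set gT}) : (A \subset centmod B) = ([~: A, B] \subset N).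
Proof.
by rewrite -sub_quotient_pre ?quotient_cents2 // (subset_trans (subsetT _)).
Qed.

Lemma in_centmod x (B : {set gT}) :
  reflect (forall b, b \in B -> [~ x, b] \in N) (x \in centmod B).
Proof.
rewrite -sub1set sub_centmod gen_subG.
apply: (iffP subsetP) => [h b Bb | h _ /imset2P[_ b /set1P-> Bb ->]]; last exact: h.
by apply: h; apply: imset2_f; rewrite ?set11.
Qed.

Lemma centmodC x y : ([~ x, y] \in N) = ([~ y, x] \in N).
Proof. by rewrite -groupV invgR. Qed.

End CommutatorModulo.

(** * The chain of the subgroups P_i *)

Let H : {group gT} := [group of two_step 2].
(* [chain i] is the subgroup [P_i] for [0 < i]. *)
Definition chain i : {group gT} := if (i <= 1)%N then H else 'L_i(G)%G.

Lemma lcn2_sub : 'L_2(G) \subset H.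
Proof. by rewrite sub_two_step; apply: (lcn_comm _ 1 1). Qed.

Lemma index_H : #|G : H| = p.
Proof. exact: index_two_step. Qed.

Lemma normal_H : H <| G.
Proof. by apply: sub_der1_normal; rewrite ?subsetT // lcn2_sub. Qed.

Lemma index_H2 : #|H : 'L_2(G)| = p.
Proof.
have := Lagrange_index (subsetT H) lcn2_sub; rewrite index_H => E.
have : #|G : 'L_2(G)| = (p * p)%N.
  rewrite -divgS ?lcn_sub // (@card_lcn 2) ?(leq_trans _ n_ge4) //.
  have e : n = (2 + (n - 2))%N by lia.
  by rewrite oG {1}e expnD mulnK ?expn_gt0 ?prime_gt0.
by rewrite -E => /eqP; rewrite eqn_pmul2l ?prime_gt0 // => /eqP.
Qed.

Lemma chain_sub i : chain i.+1 \subset chain i.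
Proof.
case: i => [|[|i]]; rewrite /chain //=; last exact: lcn_subS.
exact: lcn2_sub.
Qed.

Lemma chain_leq i j : (i <= j)%N -> chain j \subset chain i.
Proof.
elim: j => [|j IHj]; first by case: i.
by rewrite leq_eqVlt => /orP[/eqP-> // | /IHj]; apply: subset_trans (chain_sub j).
Qed.

Lemma chain_lcn i : (1 < i)%N -> chain i = 'L_i(G)%G.
Proof. by rewrite /chain; case: leqP. Qed.

Lemma chain_sub_lcn i : chain i \subset 'L_i(G).
Proof.
by case: i => [|[|i]]; rewrite /chain //= ?subsetT // lcn0 lcn1 subsetT.
Qed.

Lemma chain_index i : (0 < i < n)%N -> #|chain i : chain i.+1| = p.
Proof.
case: i => [|[|i]] // i_n; rewrite /chain /=; first exact: index_H2.
exact: index_lcn.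
Qed.

Lemma chain_ex i : (0 < i < n)%N -> exists2 u, u \in chain i & u \notin chain i.+1.
Proof.
move=> i_n; apply/subsetPn; rewrite -indexg_eq1 chain_index //.
by rewrite neq_ltn prime_gt1 ?orbT.
Qed.

Lemma chain_gen i u (W : {group gT}) : (0 < i < n)%N ->
  u \in chain i -> u \notin chain i.+1 -> u \in W -> chain i.+1 \subset W -> chain i \subset W.
Proof.
by move=> i_n; apply: prime_index_gen; rewrite ?chain_sub // chain_index.
Qed.

Lemma G_gen x (W : {group gT}) : x \notin H -> x \in W -> H \subset W -> G \subset W.
Proof.
by move=> xH; apply: prime_index_gen; rewrite ?index_H ?subsetT // in_setT.
Qed.

Lemma chain_comm i j : (0 < i)%N -> (0 < j)%N ->
  [~: chain i, chain j] \subset 'L_(i + j)(G).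
Proof.
case: i j => [|i] [|j] // _ _; rewrite addSn addnS.
by apply: subset_trans (lcn_comm _ i j); apply: commgSS; apply: chain_sub_lcn.
Qed.

Lemma chain_commG i : (0 < i)%N -> [~: chain i, G] \subset chain i.+1.
Proof.
move=> i0; rewrite (chain_lcn (i := i.+1)) //.
by apply: subset_trans (lcnSnS i G); apply: commSg; apply: chain_sub_lcn.
Qed.

Lemma lcn_nsub i : (1 < i < n)%N -> ~~ ('L_i(G) \subset 'L_i.+1(G)).
Proof.
by move=> i_n; rewrite -indexg_eq1 index_lcn // neq_ltn prime_gt1 ?orbT.
Qed.

(** Otherwise [u], hence [chain i], commutes with [x] and [H], so with [G], modulo ['L_i.+2(G)]. For
    [i] > 1 this puts ['L_i.+1(G)] inside the next term; for [i] = 1 it makes [G] abelian modulo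
    ['L_3(G)]. *)
Lemma comm_level i x u : (0 < i)%N -> (i.+2 <= n)%N -> x \notin H ->
  u \in chain i -> u \notin chain i.+1 -> [~: H, chain i] \subset 'L_i.+2(G) ->
  [~ u, x] \notin 'L_i.+2(G).
Proof.
move=> i0 i_n xH ui ui' cHi; apply/negP => ux.
set N := 'L_i.+2(G)%G; have nN : G \subset 'N(N) by apply: lcn_norm.
have cu : [set u] \subset centmod N G.
  rewrite sub_centmod // commGC -sub_centmod //; apply: (G_gen xH).
    by apply/in_centmod => // _ /set1P->; rewrite centmodC.
  rewrite sub_centmod //; apply: subset_trans cHi; apply: commgS.
  by rewrite sub1set.
have ci : chain i \subset centmod N G.
  apply: chain_gen ui ui' _ _; rewrite ?i0 1?ltnW //; first by rewrite -sub1set.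
  by rewrite sub_centmod //; apply: subset_trans (chain_commG _) _; rewrite // chain_lcn.
have [i1 | i1] := leqP i 1.
  have ei : i = 1%N by apply/eqP; rewrite eqn_leq i1.
  have sHC : H \subset centmod N G by move: ci; rewrite ei.
  have : G \subset centmod N G.
    apply: (G_gen xH) => //; rewrite -sub1set sub_centmod // commGC -sub_centmod //.
    apply: (G_gen xH).
      by apply/in_centmod => // _ /set1P->; rewrite commgg group1.
    rewrite sub_centmod //; apply: subset_trans (commgS _ (subsetT _)) _.
    by rewrite -sub_centmod.
  rewrite sub_centmod // /N ei; apply/negP; apply: (@lcn_nsub 2).
  by rewrite /= (leq_trans _ n_ge4).
have /negP[] : ~~ ('L_i.+1(G) \subset 'L_i.+2(G)) by apply: lcn_nsub; move: i0 i_n; clear; lia.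
have eL : [~: 'L_i(G), G] = 'L_i.+1(G) by case: (i) i1.
by move: ci; rewrite sub_centmod // chain_lcn //= eL.
Qed.

(** * Excluding an exceptional centralizer just above the derived subgroup *)

Section DerivedCentralizer.
Variables (k : nat) (x a : gT).
Hypothesis k_ge3 : (3 <= k)%N.
Hypothesis k_n : (k.+3 <= n)%N.
Hypothesis H'E : [~: H, H] = 'L_k.+1(G).
Hypothesis xH : x \notin H.
Hypothesis ak : a \in chain k.
Hypothesis ak' : a \notin chain k.+1.
Hypothesis axk : [~ a, x] \in 'L_k.+2(G).

Let N2 := 'L_k.+2(G)%G.
Let N3 := 'L_k.+3(G)%G.
Let nN2 : G \subset 'N(N2). Proof. exact: lcn_norm. Qed.
Let nN3 : G \subset 'N(N3). Proof. exact: lcn_norm. Qed.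
Let k_gt0 : (0 < k)%N. Proof. exact: leq_trans k_ge3. Qed.

Let e0_ex : exists u, (u \in chain 1) && (u \notin chain 2).
Proof.
by have [|u u1 u2] := @chain_ex 1; [rewrite /= (leq_trans _ n_ge4) | exists u; rewrite u1].
Qed.
(* The usual generators, with indices shifted: [e i] is [s_(i+1)]. *)
Let e i := iter i (fun u => [~ u, x]) (xchoose e0_ex).

Let e_in i : e i \in chain i.+1.
Proof.
elim: i => [|i IHi]; first by case/andP: (xchooseP e0_ex).
by apply: (subsetP (chain_commG (ltn0Sn i))); rewrite mem_commg.
Qed.

Let eH i : e i \in H.
Proof. by have := subsetP (@chain_leq 1 i.+1 _) _ (e_in i); apply. Qed.

Let e_notin i : (i < k)%N -> e i \notin chain i.+2.
Proof.
elim: i => [|i IHi] lt_ik; first by case/andP: (xchooseP e0_ex).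
rewrite (chain_lcn (i := i.+3)) //.
apply: (@comm_level i.+1); rewrite ?e_in ?IHi ?(ltnW lt_ik) //.
  by move: k_n lt_ik; clear; lia.
apply: subset_trans (commgS _ (@chain_leq 1 i.+1 _)) _ => //.
by rewrite -[chain 1]/H H'E lcn_sub_leq.
Qed.

Let H'G u v : u \in H -> v \in H -> [~ u, v] \in 'L_k.+1(G).
Proof. by move=> Hu Hv; rewrite -H'E mem_commg. Qed.

Let ek1 : e k.-1 \in chain k.
Proof. by have := e_in k.-1; rewrite prednK. Qed.

Let ek1' : e k.-1 \notin chain k.+1.
Proof. by have := @e_notin k.-1; rewrite prednK //; apply. Qed.

(** Modulo [chain k.+1] the element [a] generates [chain k], so all of [chain k] commutes with [x]
    modulo [N2]. *)
Let ek : e k \in N2.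
Proof.
have s : chain k \subset centmod N2 [set x].
  apply: (chain_gen _ ak ak'); first by move: k_ge3 k_n; clear; lia.
    by apply/in_centmod => // _ /set1P->.
  rewrite sub_centmod //; apply: subset_trans (commgS _ (subsetT _)) _.
  by have := chain_commG (ltn0Sn k); rewrite (chain_lcn (i := k.+2)).
have /subsetP/(_ _ ek1) := s.
have -> : e k = [~ e k.-1, x] by rewrite -{1}(prednK k_gt0).
by move/(in_centmod nN2); apply; apply: set11.
Qed.

(** As [e i] has weight [i + 1], the commutators [w i] have weight [k + 1] and the [c i] weight
    [k + 2]. *)
Let w i := [~ e i, e (k.-1 - i)%N].
Let c i := [~ e i, e (k - i)%N].

(** Otherwise [H] would centralize [chain k] modulo [N2], and [comm_level] would contradict the
    choice of [a]. *)
Let w0_notin : w 0 \notin N2.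
Proof.
have lcnk2 (A : {group gT}) : [~: 'L_k.+1(G), A] \subset N2.
  by rewrite /= lcnSn commgS // subsetT.
apply/negP; rewrite /w subn0 => w0.
have s1 : [set e k.-1] \subset centmod N2 H.
  rewrite sub_centmod // commGC -sub_centmod // -[H]/(chain 1 : {group gT}).
  apply: (chain_gen _ (e_in 0)); rewrite ?e_notin //; first by rewrite /= (leq_trans _ n_ge4).
    by apply/in_centmod => // _ /set1P->.
  rewrite sub_centmod //; apply: subset_trans (commgS _ _) _; last first.
    exact: (@chain_comm 2 k).
  by rewrite sub1set.
have s2 : chain k \subset centmod N2 H.
  apply: (chain_gen _ ek1 ek1'); first by move: k_ge3 k_n; clear; lia.
    by rewrite -sub1set.
  by rewrite sub_centmod // chain_lcn // lcnk2.
have /negP[] : [~ a, x] \notin N2.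
  by apply: comm_level; rewrite ?k_gt0 1?ltnW // commGC -sub_centmod.
exact: axk.
Qed.

Let commG_in j u g : u \in 'L_j(G) -> [~ u, g] \in 'L_j.+1(G).
Proof. by move=> Lu; apply: (subsetP (lcnSnS j G)); rewrite mem_commg. Qed.

Let central_mod j u g : u \in 'L_j(G) ->
  commute (coset 'L_j.+1(G) u) (coset 'L_j.+1(G) g).
Proof.
have nN : G \subset 'N('L_j.+1(G)) by apply: lcn_norm.
by move=> Lu; apply/commgP; rewrite -cosetR // coset1P // commG_in.
Qed.

Let conj_eS i : e i ^ x = e i * e i.+1.
Proof. by rewrite mulKVg. Qed.

Let N2_central u v g : u \in H -> v \in H -> commute [~ coset N2 u, coset N2 v] g.
Proof.
move=> Hu Hv; have [y ->] := coset_surj g.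
by rewrite -cosetR //; apply: (@central_mod k.+1) => //; apply: H'G.
Qed.

Let N2_bilin u1 u2 v1 v2 : u1 \in H -> u2 \in H -> v1 \in H -> v2 \in H ->
  coset N2 [~ u1 * u2, v1 * v2] = coset N2 [~ u1, v1] * coset N2 [~ u1, v2] *
    (coset N2 [~ u2, v1] * coset N2 [~ u2, v2]).
Proof.
move=> *; rewrite !cosetR // !cosetM //.
apply: (@central_commM _ (H / N2)); rewrite ?mem_quotient //.
move=> _ _ g /morphimP[u _ Hu ->] /morphimP[v _ Hv ->] _; exact: N2_central.
Qed.

(** Conjugation by [x] fixes [[~ e i, e j]] modulo [N2]. Expanding the conjugate leaves
    [w i * w i.+1] and a factor of weight [k + 2]. *)
Let wS i : (i.+1 < k)%N -> w i * w i.+1 \in N2.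
Proof.
move=> i_k; set j := (k.-1 - i.+1)%N.
have ej : (k.-1 - i = j.+1)%N by rewrite /j; move: i_k k_ge3; clear; lia.
rewrite /w ej -/j.
have H1 : coset N2 ([~ e i, e j] ^ x) = coset N2 [~ e i, e j].
  rewrite cosetJ // conjgE (@central_mod k.+1) ?mulKg // ?H'G //.
move: H1; rewrite conjRg !conj_eS N2_bilin // -mulgA.
rewrite -[RHS]mulg1 => /mulgI; rewrite [X in _ * (_ * X)](_ : _ = 1) ?mulg1.
  by rewrite -cosetM // => /eqP; rewrite coset1P.
apply/eqP; rewrite coset1P //.
have := subsetP (@chain_comm i.+2 j.+2 isT isT) _ (mem_commg (e_in _) (e_in _)).
by apply: subsetP; apply: lcn_sub_leq; rewrite /j; move: i_k k_ge3; clear; lia.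
Qed.

Let w_notin i : (i < k)%N -> w i \notin N2.
Proof.
elim: i => [|i IHi] i_k; first exact: w0_notin.
by apply: contra (IHi (ltnW i_k)) => wi; rewrite -(groupMr _ wi) wS.
Qed.

(** For odd [k] the middle [w] is the commutator of an element with itself. *)
Let k_even : k = (k./2).*2.
Proof.
rewrite -[LHS]odd_double_half; case odd_k: (odd k) => //.
have lt_k : (k./2 < k)%N by move: k_ge3; clear; lia.
have /negP[] := w_notin lt_k; rewrite /w.
have -> : (k.-1 - k./2 = k./2)%N by move: odd_k; clear; lia.
by rewrite commgg group1.
Qed.

(** The element [w 1] generates ['L_k.+1(G)] modulo the next term and lies in
    [[~: 'L_2(G), 'L_k.-1(G)]]. The three subgroup lemma handles the latter, since 2k >= k + 3. *)
Let H'_central : 'L_k.+1(G) \subset centmod N3 H.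
Proof.
have nT (A : {set gT}) : A \subset 'N(N3) by apply: subset_trans (subsetT A) nN3.
have sH'R (A : {group gT}) : A \subset H -> [~: H, A] \subset 'L_k.+1(G).
  by move=> sA; rewrite -H'E commgS.
have sLH i : (1 < i)%N -> 'L_i(G) \subset H.
  by move=> i1; have := @chain_leq 1 i (ltnW i1); rewrite chain_lcn.
have s3 : [~: 'L_2(G), 'L_k.-1(G), H] \subset N3.
  apply: three_subgroup_sub; rewrite ?nT //.
    rewrite (commGC _ H).
    apply: subset_trans (commSg _ (sH'R 'L_k.-1(G)%G (sLH _ _))) _.
      by move: k_ge3; clear; lia.
    by have := lcn_comm G k 1; rewrite addn1.
  apply: subset_trans (commSg _ (sH'R 'L_2(G)%G lcn2_sub)) _.
  rewrite (_ : k.-1 = k.-2.+1); last by move: k_ge3; clear; lia.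
  apply: subset_trans (lcn_comm G k k.-2) _; apply: lcn_sub_leq.
  by move: k_ge3; clear; lia.
have w1 : w 1 \in 'L_k.+1(G) by apply: H'G.
have w1' : w 1 \notin 'L_k.+2(G) by apply: w_notin; move: k_ge3; clear; lia.
apply: (lcn_gen _ w1 w1').
- by move: k_ge3 k_n; clear; lia.
- apply/in_centmod => // b Hb; apply: (subsetP s3); apply: mem_commg => //.
  apply: mem_commg; first by have := e_in 1.
  have := e_in (k.-1 - 1); rewrite chain_lcn; last by move: k_ge3; clear; lia.
  by rewrite (_ : (k.-1 - 1).+1 = k.-1) //; move: k_ge3; clear; lia.
rewrite sub_centmod //; apply: subset_trans (commgS _ (subsetT _)) _.
exact: lcnSnS.
Qed.

Let N3_central u v g : u \in H -> v \in H -> g \in H ->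
  commute [~ coset N3 u, coset N3 v] (coset N3 g).
Proof.
move=> Hu Hv Hg; apply/commgP; rewrite -!cosetR // coset1P //.
by have /(in_centmod nN3) := subsetP H'_central _ (H'G Hu Hv); apply.
Qed.

Let N3_bilin u1 u2 v1 v2 : u1 \in H -> u2 \in H -> v1 \in H -> v2 \in H ->
  coset N3 [~ u1 * u2, v1 * v2] = coset N3 [~ u1, v1] * coset N3 [~ u1, v2] *
    (coset N3 [~ u2, v1] * coset N3 [~ u2, v2]).
Proof.
move=> *; rewrite !cosetR // !cosetM //.
apply: (@central_commM _ (H / N3)); rewrite ?mem_quotient //.
move=> _ _ _ /morphimP[u _ Hu ->] /morphimP[v _ Hv ->] /morphimP[g _ Hg ->].
exact: N3_central.
Qed.

Let g i := coset N3 [~ w i, x].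

(** Conjugation by [x] again, now one weight higher: [[~ w i, x]] compares [w i] with its expanded
    conjugate modulo [N3]. *)
Let gE i : (i < k)%N -> g i = coset N3 (c i) * coset N3 (c i.+1).
Proof.
move=> i_k; set j := (k.-1 - i)%N.
have ej : (k - i = j.+1)%N by rewrite /j; move: i_k k_ge3; clear; lia.
have ej' : (k - i.+1 = j)%N by rewrite /j; move: i_k k_ge3; clear; lia.
rewrite /g /c /w ej ej' -/j commgEl cosetM // cosetV // conjRg !conj_eS N3_bilin //.
rewrite -mulgA mulKg (_ : coset N3 [~ e i.+1, e j.+1] = 1) ?mulg1 //.
apply/eqP; rewrite coset1P //.
have := subsetP (@chain_comm i.+2 j.+2 isT isT) _ (mem_commg (e_in _) (e_in _)).
by apply: subsetP; apply: lcn_sub_leq; rewrite /j; move: i_k k_ge3; clear; lia.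
Qed.

Let gS i : (i.+1 < k)%N -> g i.+1 = (g i)^-1.
Proof.
move=> i_k; have wz := wS i_k; set z := w i * w i.+1 in wz.
have wSE : w i.+1 = (w i)^-1 * z by rewrite mulKg.
have cz (q : coset_of N3) : commute (coset N3 z) q.
  by have [y ->] := coset_surj q; apply: (@central_mod k.+2).
have gN : [~ w i, x] \in 'L_k.+2(G) by apply/commG_in/H'G.
have cg : commute (coset N3 (w i)) (g i).
  by apply: commute_sym; apply: (@central_mod k.+2).
rewrite /g wSE commMgJ cosetM // cosetJ // ![coset N3 [~ _, _]]cosetR //.
have -> : [~ coset N3 z, coset N3 x] = 1 by apply/eqP/commgP.
rewrite mulg1 conjgE -(cz ([~ coset N3 (w i)^-1, coset N3 x])) mulKg cosetV //.
by rewrite commVg // -cosetR.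
Qed.

Let g_in i : (i < k)%N -> g i \in 'L_k.+2(G) / N3.
Proof. by move=> _; exact/mem_quotient/commG_in/H'G. Qed.

(** If [g 0] were trivial, [x] and [H] would both centralize ['L_k.+1(G)] modulo [N3], forcing
    ['L_k.+2(G)] into [N3]. *)
Let g_ne1 i : (i < k)%N -> g i != 1.
Proof.
elim: i => [|i IHi] i_k; last by rewrite gS // invg_eq1 IHi // ltnW.
rewrite coset1P //; apply/negP => w0x.
have s1 : 'L_k.+1(G) \subset centmod N3 [set x].
  apply: (lcn_gen _ (H'G (eH 0) (eH (k.-1 - 0))) w0_notin).
  - by move: k_ge3 k_n; clear; lia.
  - by apply/in_centmod => // _ /set1P->.
  rewrite sub_centmod //; apply: subset_trans (commgS _ (subsetT _)) _.
  exact: lcnSnS.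
have : G \subset centmod N3 'L_k.+1(G).
  apply: (G_gen xH).
    by rewrite -sub1set sub_centmod // commGC -sub_centmod.
  by rewrite sub_centmod // commGC -sub_centmod.
rewrite sub_centmod // commGC -lcnSn; apply/negP.
by apply: lcn_nsub.
Qed.

(** The recursion of [gE] starts at [c 0], trivial modulo [N3] because of [ek]; the alternating
    signs of [g] make the exponents add up. *)
Let c_pow i : (i < k)%N -> coset N3 (c i.+1) = g i ^+ i.+1.
Proof.
elim: i => [|i IHi] i_k.
  rewrite gE // [coset N3 (c 0)](_ : _ = 1) ?mul1g //; apply/eqP; rewrite coset1P //.
  by rewrite /c subn0 centmodC; apply: commG_in ek.
apply: (mulgI (coset N3 (c i.+1))); rewrite -gE // IHi ?(ltnW i_k) //.
by rewrite gS // (expgSr _ i.+1) expVgn mulgA mulgV mul1g.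
Qed.

(** The middle commutator [c k./2] is trivial, while by [c_pow] it is the power [k./2] of an element
    of order [p]. *)
Let p_le_half : (p <= k./2)%N.
Proof.
have l_gt0 : (0 < k./2)%N by move: k_ge3; clear; lia.
have l_k : (k./2.-1 < k)%N by move: k_ge3; clear; lia.
have := c_pow l_k; rewrite prednK // /c.
have -> : (k - k./2 = k./2)%N by rewrite {1}k_even -addnn addnK.
rewrite commgg (_ : coset N3 1 = 1) => [/esym/eqP|]; last exact: morph1.
rewrite -order_dvdn => dvd_l; apply: leq_trans (dvdn_leq l_gt0 dvd_l).
have := order_dvdG (g_in l_k); rewrite card_quotient; last exact: subset_trans (subsetT _) nN3.
rewrite index_lcn //; case/(primeP p_pr).2/orP => /eqP; last by move=> ->.
by move/eqP; rewrite order_eq1 (negPf (g_ne1 l_k)).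
Qed.

Let k_le_p : (k <= p)%N.
Proof.
rewrite leqNgt; apply/negP => p_k.
(* Modulo [N2] the map [f] is additive in its conjugated entry, so [x] acts on it as 1 plus a shift.
   As [x ^+ p] lies in [H], its [p]-th power acts trivially; starting at [k.-1 - p],
   [binomial_shift] then forces [w 0] to be trivial. *)
pose f i j := coset N2 [~ e 0, e i ^ (x ^+ j)].
have nH u y : u \in H -> u ^ y \in H.
  by move=> Hu; rewrite memJ_norm // (subsetP (normal_norm normal_H)).
have fS i j : f i j.+1 = f i j * f i.+1 j.
  rewrite /f expgS conjgM conj_eS conjMg -[e 0]mulg1 N2_bilin ?nH //.
  by rewrite !comm1g (_ : coset N2 1 = 1) ?mulg1 //; apply/eqP; rewrite coset1P.
have oL : #|'L_k.+1(G) / N2| = p.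
  rewrite card_quotient; last exact: subset_trans (subsetT _) nN2.
  by rewrite index_lcn //; move: k_ge3 k_n; clear; lia.
have fL i : f i 0 \in 'L_k.+1(G) / N2 by apply/mem_quotient/H'G; rewrite ?nH.
pose v := coset N2 (w 0).
have Lv : v \in 'L_k.+1(G) / N2 by apply/mem_quotient/H'G.
have v1 : v != 1 by rewrite coset1P.
have ov : #[v] = p.
  have := order_dvdG Lv; rewrite oL; case/(primeP p_pr).2/orP => /eqP // /eqP.
  by rewrite order_eq1 (negPf v1).
have Lcyc : 'L_k.+1(G) / N2 = <[v]>.
  by apply/esym/eqP; rewrite eqEcard cycle_subG Lv oL -orderE ov /=.
set i := (k.-1 - p)%N.
have shift : f i p = f i 0 * f (i + p)%N 0.
  apply: (binomial_shift _ (w := v) p_pr) => // [|l]; last by rewrite -Lcyc.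
  by rewrite -ov expg_order.
rewrite subnK in shift; last by move: p_k; clear; lia.
have fk : f k.-1 0 = v by rewrite /f conjg1 /v /w subn0.
have xp : x ^+ p \in H.
  have nHG := normal_norm normal_H; rewrite -coset1P // cosetX // -order_dvdn.
  have := order_dvdG (mem_quotient H (in_setT x)).
  by rewrite card_quotient // index_H.
have fp : f i p = f i 0.
  have cL := H'G (eH i) xp; have cH : [~ e i, x ^+ p] \in H by rewrite groupR ?eH.
  have N2c : coset N2 [~ e 0, [~ e i, x ^+ p]] = 1.
    by apply/eqP; rewrite coset1P // centmodC; apply: commG_in.
  rewrite /f conjg1 conjg_mulR -[e 0]mulg1 N2_bilin // mulg1 N2c.
  by rewrite !comm1g (_ : coset N2 1 = 1) ?mulg1 //; exact: morph1.
move: shift; rewrite fp fk => /eqP.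
by rewrite -{1}[f i 0]mulg1 (inj_eq (mulgI _)) eq_sym (negPf v1).
Qed.

Lemma derived_centralizer_contra : False.
Proof. by move: p_le_half k_le_p k_ge3; clear; lia. Qed.

End DerivedCentralizer.

(** * Position of the derived subgroup and the equivalence *)

Lemma chain_level h j : h \in H -> h \notin chain j ->
  exists2 i, (0 < i < j)%N & h \in chain i /\ h \notin chain i.+1.
Proof.
move=> Hh; elim: j => [|j IHj] hj; first by rewrite /chain /= Hh in hj.
have [hj' | /IHj[i i_j hi]] := boolP (h \in chain j); last first.
  by exists i => //; move: i_j; clear; lia.
by exists j => //; case: (j) hj => [|i] //=; rewrite /chain /= Hh.
Qed.

(** [H] is generated by ['L_2(G)] and one element [u]. It centralizes ['L_2(G)] modulo ['L_4(G)] by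
    definition, and [u] commutes with itself. *)
Lemma derived_sub4 : [~: H, H] \subset 'L_4(G).
Proof.
have nN : G \subset 'N('L_4(G)) by apply: lcn_norm.
have cL : [~: 'L_2(G), H] \subset 'L_4(G) by rewrite commGC -sub_two_step.
have i1n : (0 < 1 < n)%N by rewrite /= (leq_trans _ n_ge4).
have [u u1 u2] := chain_ex i1n.
have cu : H \subset centmod 'L_4(G)%G [set u].
  apply: (chain_gen i1n u1 u2); first by apply/in_centmod => // _ /set1P->; rewrite commgg.
  by rewrite sub_centmod //; apply: subset_trans cL; apply: commgS; rewrite sub1set.
rewrite -(sub_centmod (N := 'L_4(G)%G)) //; apply: (chain_gen i1n u1 u2).
  by rewrite -sub1set sub_centmod // commGC -sub_centmod.
by rewrite sub_centmod.
Qed.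

Lemma derived_lcn : exists2 m, (3 < m <= n)%N & [~: H, H] = 'L_m(G).
Proof.
have nM : [~: H, H] <| G by apply: char_normal_trans (der_char 1 H) normal_H.
have [|m m_n E] := normal_lcn nM.
  by apply: subset_trans derived_sub4 _; apply: lcn_sub_leq.
exists m => //; rewrite ltnNge; case/andP: m_n => m1 ->; rewrite andbT; apply/negP => m3.
have /negP[] : ~~ ('L_m(G) \subset 'L_m.+1(G)).
  by apply: lcn_nsub; move: m1 m3 n_ge4; clear; lia.
by rewrite -E; apply: subset_trans derived_sub4 _; apply: lcn_sub_leq.
Qed.

Lemma prime_subgroup_eq (A B : {group gT}) :
  prime #|B| -> A \subset B -> A :!=: 1 -> A :=: B.
Proof.
move=> prB sAB ntA; apply/eqP; rewrite eqEsubset sAB prime_meetG //.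
by rewrite (setIidPr sAB).
Qed.

Lemma card_lcn_pred : #|'L_n.-1(G)| = p.
Proof.
rewrite card_lcn; last by move: n_ge4; clear; lia.
by rewrite (_ : n - n.-1 = 1)%N //; move: n_ge4; clear; lia.
Qed.

Lemma commH_lcn : [~: H, 'L_(n - 2)(G)] \subset 'L_n.-1(G).
Proof.
rewrite (_ : n.-1 = (n - 2).+1); last by move: n_ge4; clear; lia.
by rewrite commGC; apply: subset_trans (commgS _ (subsetT _)) (lcnSnS _ _).
Qed.

Lemma commH_sub : [~: H, 'L_(n - 2)(G)] \subset [~: H, H].
Proof.
apply: commgS; apply: subset_trans lcn2_sub; apply: lcn_sub_leq.
by move: n_ge4; clear; lia.
Qed.

Lemma centralizer_derived x h : [~: H, H] <> [~: H, 'L_(n - 2)(G)] ->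
  x \notin H -> h \in H -> commute h x -> h \in [~: H, H].
Proof.
move=> neM xH Hh chx; have [m m_n Em] := derived_lcn.
have hx1 : [~ h, x] = 1 by apply/eqP/commgP.
have hx j : [~ h, x] \in 'L_j(G) by rewrite hx1 group1.
apply: contraT => hM.
have m_lt : (m < n)%N.
  rewrite ltn_neqAle; case/andP: m_n => _ ->; rewrite andbT; apply/eqP => mn.
  case: neM; apply/eqP; rewrite eqEsubset commH_sub andbT Em mn lcn_n; exact: sub1G.
have [|i i_m [hi hi']] := @chain_level h m Hh.
  by rewrite chain_lcn ?Em // in hM *; move: m_n; clear; lia.
have i_n : (i.+2 <= n)%N by move: i_m m_lt; clear; lia.
have sHi : [~: H, chain i] \subset 'L_m(G).
  by rewrite -Em commgS //; have := @chain_leq 1 i; apply; case/andP: i_m.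
(* If [i] is at most m - 2, then [[~: H, chain i]] lies deep enough for [comm_level]; only [i] = m -
   1 is left. *)
have [i2m | m_i] := leqP i.+2 m.
  have /negP[] : [~ h, x] \notin 'L_i.+2(G); last exact: hx.
  apply: comm_level => //; first by case/andP: i_m.
  exact: subset_trans sHi (lcn_sub_leq _ i2m).
have Ei : m = i.+1 by move: i_m m_i; clear; lia.
have [i3n | n_i] := leqP i.+3 n.
  case: (@derived_centralizer_contra i x h) => //; last by rewrite Em Ei.
  by move: m_n Ei; clear; lia.
(* The last case is m = n - 1. Were this subgroup trivial, [comm_level] at level n - 2 would apply;
   so it fills ['L_n.-1(G)], which has order [p], and equals the derived subgroup. *)
have nt : [~: H, 'L_(n - 2)(G)] != 1.
  apply: contraTneq (hx i.+2) => H1; apply: (comm_level (i := i)) => //; first by case/andP: i_m.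
  rewrite chain_lcn; last by move: m_n Ei; clear; lia.
  by rewrite (_ : i = n - 2)%N ?H1 ?sub1G //; move: i_n n_i; clear; lia.
case: neM; rewrite Em (_ : m = n.-1); last by move: Ei i_n n_i; clear; lia.
by apply/esym/prime_subgroup_eq; rewrite ?card_lcn_pred ?commH_lcn.
Qed.

Lemma notin_H_ex : exists s, s \notin H.
Proof.
have /subsetPn[s _ sH] : ~~ (G \subset H); last by exists s.
by rewrite -indexg_eq1 index_H neq_ltn prime_gt1 ?orbT.
Qed.

Lemma mem_H_cycle s g : s \notin H -> exists2 h, h \in H & exists j, g = h * s ^+ j.
Proof.
move=> sH; have : g \in H * <[s]>.
  rewrite -norm_joinEr; last exact: subset_trans (subsetT _) (normal_norm normal_H).
  apply: (subsetP (@G_gen s (H <*> <[s]>)%G sH _ _)); rewrite ?in_setT ?joing_subl //.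
  by apply: (subsetP (joing_subr _ _)); apply: cycle_id.
by case/mulsgP=> h _ Hh /cycleP[j ->] ->; exists h => //; exists j.
Qed.

Lemma B0_trivial_maximal_class :
  B0_trivial gT <-> [~: H, H] = [~: H, 'L_(n - 2)(G)].
Proof.
have nHG h g : h \in H -> h ^ g \in H.
  by move=> Hh; rewrite memJ_norm // (subsetP (normal_norm normal_H)).
split=> [B0 | EM].
  apply/eqP; apply: contraT => /eqP neM; have [s sH] := notin_H_ex.
  have [m m_n Em] := derived_lcn.
  have [|a a1 a2] := @chain_ex m.-1.
    rewrite -subn1 subn_gt0 ltn_neqAle.
    have m_ne : m != n.
      apply/eqP => mn; case: neM; apply/eqP.
      by rewrite eqEsubset commH_sub andbT Em mn lcn_n; apply: sub1G.
    by move: m_n m_ne; clear; lia.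
  have m0 : (0 < m.-1)%N by move: m_n; clear; lia.
  rewrite prednK ?chain_lcn in a2; try by move: m_n; clear; lia.
  have aH : a \in H by apply: (subsetP (@chain_leq 1 m.-1 m0)).
  case: (@B0_nontrivial gT H p s a p_pr (normal_norm normal_H) index_H sH _ aH) => //.
  - by move=> x h xH Hh; apply: centralizer_derived.
  - by rewrite Em.
  rewrite Em; have := subsetP (chain_commG m0) _ (mem_commg a1 (in_setT s)).
  by rewrite prednK ?chain_lcn //; move: m_n; clear; lia.
have [M1 | ntM] := eqVneq [~: H, H] 1.
  have [s sH] := notin_H_ex.
  have abH : abelian H by apply/commG1P.
  apply: (B0_trivial_normal_form nHG (fun g => mem_H_cycle g sH)); last by left.
    move=> h k g Hh Hk; rewrite (_ : [~ h, k] = 1); first exact/commute_sym/commute1.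
    by apply/eqP/commgP/(centsP abH).
  by move=> h _; rewrite M1 => /set1P.
have EL : [~: H, H] = 'L_n.-1(G).
  have := ntM; rewrite EM => ntL.
  by apply: prime_subgroup_eq; rewrite ?card_lcn_pred ?commH_lcn.
have n2 : (1 < n - 2)%N by move: n_ge4; clear; lia.
have n2n : ((n - 2).+2 = n)%N by move: n_ge4; clear; lia.
have Cn u g : u \in 'L_n.-1(G) -> commute u g.
  move=> Lu; apply/commgP; rewrite -in_set1 -[[set 1]]/(1 : {set gT}) -lcn_n.
  rewrite -[n in 'L_n(_)](prednK n_gt0).
  by apply: (subsetP (lcnSnS _ _)); rewrite mem_commg.
(* Both groups have index [p], and [H] does not centralize ['L_(n - 2)(G)], so [two_step (n - 2)] is
   not contained in [H]. *)
have [s s2 sH] : exists2 s, s \in two_step (n - 2) & s \notin H.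
  apply/subsetPn; apply/negP => sKH.
  have EK : two_step (n - 2) = H.
    apply/eqP; rewrite eqEcard sKH /=.
    have i1 : #|G : two_step (n - 2)| = p by rewrite index_two_step ?n2n.
    have LH := Lagrange (subsetT H); rewrite index_H in LH.
    have LK := Lagrange (subsetT [group of two_step (n - 2)]); rewrite i1 in LK.
    by rewrite -(leq_pmul2r (prime_gt0 p_pr)) LH LK.
  case/eqP: ntM; rewrite EM; apply/trivgP; rewrite -lcn_n.
  by have := sub_two_step H (n - 2); rewrite n2n EK subxx.
apply: (B0_trivial_normal_form nHG (fun g => mem_H_cycle g sH)); last first.
- by right; rewrite EL card_lcn_pred.
(* Inside [chain (n - 2)] the choice of [s] gives commutation. Outside it, [comm_level] keeps
   [[~ h, s]] out of a term that contains ['L_n.-1(G)]. *)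
- move=> h Hh; rewrite EL => hs; have [hL | hL] := boolP (h \in chain (n - 2)).
    have : [~ s, h] \in 'L_(n - 2).+2(G).
      have : two_step (n - 2) \subset two_step (n - 2) by [].
      rewrite sub_two_step => /subsetP; apply; apply: mem_commg => //.
      by rewrite chain_lcn in hL.
    by rewrite n2n lcn_n => /set1P s1; apply/eqP; rewrite -invgR s1 invg1.
  have [i i_n [hi hi']] := chain_level Hh hL.
  have /negP[] : [~ h, s] \notin 'L_i.+2(G).
    apply: comm_level => //; try by move: i_n; clear; lia.
    have sc : [~: H, chain i] \subset [~: H, H].
      by apply: commgS; have := @chain_leq 1 i; apply; case/andP: i_n.
    by apply: subset_trans sc _; rewrite EL; apply: lcn_sub_leq; move: i_n; clear; lia.
  by apply: (subsetP (lcn_sub_leq G (_ : (i.+2 <= n.-1)%N)) _ hs); move: i_n; clear; lia.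
by move=> h k g Hh Hk; apply: Cn; rewrite -EL mem_commg.
Qed.

End MaximalClass.

Theorem theorem1 (p n : nat) (gT : finGroupType)
  (hp : prime p) (hn : (4 <= n)%N)
  (hord : #|[set: gT]| = (p ^ n)%N)
  (hcl : nil_class [set: gT] = n.-1) :
  B0_trivial gT <->
  [~: P1 [set: gT], P1 [set: gT]] = [~: P1 [set: gT], 'L_((n - 2)%N)([set: gT])].
Proof. exact: B0_trivial_maximal_class hp hn hord hcl. Qed.
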